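(* Let $(h,(E,\tau,I),\Phi,\nabla^{+},\nabla^{-})$ be a quasi-Codazzi structure on an $n$-dimensional smooth manifold $M$. Suppose that $\Phi^{+}$ and $\Phi^{-}$ are isomorphisms (i.e., $h$ is non-degenerate), and let $\widetilde{\nabla}^{\pm}$ be the connections on $TM$ defined by $\Phi^{\pm}(\widetilde{\nabla}^{\pm}_XY)=\nabla^{\pm}_X\Phi^{\pm}(Y)$ for $X,Y\in\Gamma(TM)$. Then this structure is isomorphic to the quasi-Codazzi structure $$\left(h,(TM\oplus T^{*}M,\widehat{\tau},\widehat{I}),\ \mathrm{id}_{TM}\oplus\tfrac12\widetilde{h},\ \widehat{\nabla}^{+},\widehat{\nabla}^{-}\right),$$ where $\widetilde{h}:TM\to T^{*}M$, $\widetilde h(X)=h(X,-)$; $\widehat{\tau}(X\oplus\alpha,Y\oplus\beta)=\beta(X)+\alpha(Y)$; $\widehat{I}(X\oplus\alpha)=X\oplus(-\alpha)$; $\widehat{\nabla}^{+}_XY=\widetilde{\nabla}^{+}_XY$ on $TM$; and $\widehat{\nabla}^{-}_X\widetilde{h}(Y)=\widetilde{h}(\widetilde{\nabla}^{-}_XY)$ on $T^{*}M$.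
   Context: Everything is $C^\infty$. Para-Hermitian vector bundle on $M$ ($\dim M=n$): a triple $(E,\tau,I)$ where $E\to M$ is a vector bundle of rank $2n$, $\tau$ is a pseudo-Riemannian metric on the bundle $E$ (smooth fiberwise non-degenerate symmetric bilinear form), and $I:E\to E$ is a bundle map with (a) $I^2=\mathrm{id}$, $I\ne\mathrm{id}$; (b) the eigenbundles $E^{+}$, $E^{-}$ of $I$ for the eigenvalues $1$, $-1$ have the same rank and $E=E^{+}\oplus E^{-}$; (c) $\tau(IX,Y)+\tau(X,IY)=0$. Put $\omega(X,Y):=\tau(X,IY)$. Quasi-Codazzi structure on $M$: data $(h,(E,\tau,I),\Phi,\nabla^{+},\nabla^{-})$ where $(E,\tau,I)$ is a para-Hermitian vector bundle of rank $2n$ on $M$; $\Phi:TM\to E$ is a bundle map such that for every $p\in M$, $\mathrm{rank}\,\Phi_p=n$ and $\Phi_p(T_pM)$ is Lagrangian (i.e., $\omega$ vanishes on it); $h(Y,Z):=\tau(\Phi(Y),\Phi(Z))$; $\nabla^{+}$ is a connection on $E^{+}$ and $\nabla^{-}$ is the dual connection on $E^{-}$, i.e. $X\tau(\nu^{+},\nu^{-})=\tau(\nabla^{+}_X\nu^{+},\nu^{-})+\tau(\nu^{+},\nabla^{-}_X\nu^{-})$ for $X\in\Gamma(TM)$, $\nu^{\pm}\in\Gamma(E^{\pm})$; and, with $\Phi^{\pm}:=\pi^{\pm}\circ\Phi$ ($\pi^{\pm}:E\to E^{\pm}$ the projections), $\nabla^{\pm}_X\Phi^{\pm}(Y)-\nabla^{\pm}_Y\Phi^{\pm}(X)-\Phi^{\pm}([X,Y])=0$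 for all $X,Y\in\Gamma(TM)$ (relative torsion-freeness). Isomorphism: two quasi-Codazzi structures $A_i=(h_i,(E_i,\tau_i,I_i),\Phi_i,\nabla_i^{+},\nabla_i^{-})$, $i=1,2$, on $M$ are isomorphic if there is a bundle isomorphism $F:E_1\to E_2$ over $\mathrm{id}_M$ such that (i) $F\circ\Phi_1=\Phi_2$; (ii) $F\circ I_1=I_2\circ F$; (iii) $\tau_1(\nu,\kappa)=\tau_2(F(\nu),F(\kappa))$ for $\nu,\kappa\in\Gamma(E_1)$; (iv) $F(\nabla^{\pm}_{1\,X}\nu^{\pm})=\nabla^{\pm}_{2\,X}F(\nu^{\pm})$ for $X\in\Gamma(TM)$, $\nu^{\pm}\in\Gamma(E_1^{\pm})$. *)

(* Defs.v *)
From HB Require Import structures.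
From mathcomp Require Import all_boot all_order all_algebra.
From mathcomp Require Import boolp classical_sets functions cardinality reals topology normedtype landau derive.
Set Implicit Arguments. Unset Strict Implicit. Unset Printing Implicit Defensive.
Import Order.TTheory GRing.Theory Num.Theory.
Import numFieldNormedType.Exports.
Local Open Scope classical_set_scope.
Local Open Scope ring_scope.

(* [Ck k U f]: f is of class C^k on the open set U. Every C^(k+1) function is
   required to be Frechet differentiable, with all directional derivatives
   of class C^k; for V = R^m this is the usual notion. *)
Fixpoint Ck (R : realType) (V W : normedModType R) (k : nat) (U : set V)
    (f : V -> W) : Prop :=
  if k is k'.+1 then
    (forall x, U x -> differentiable f x) /\ forall v, Ck k' U ('D_v f)
  else forall x, U x -> {for x, continuous f}.

Definition smooth_on (R : realType) (m : nat) (W : normedModType R)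
    (U : set 'rV[R]_m) (f : 'rV[R]_m -> W) : Prop :=
  forall k, Ck k U f.

Section Calculus.
Variable R : realType.

Lemma near_eq_differentiable (V W : normedModType R) (f g : V -> W) (x : V) :
  (\near x, f x = g x) -> differentiable f x -> differentiable g x.
Proof.
move=> fg /diff_locallyP[dfc dfx].
have gx : g x = f x by rewrite (nbhs_singleton fg).
have H : g \o shift x = cst (g x) + 'd f x +o_ 0 id.
  apply/eqaddoP => e e0; move/eqaddoP : dfx => /(_ e e0) H.
  have fg0 : \forall h \near 0, f (h + x) = g (h + x).
    by move: fg; rewrite (near_shift 0) /= subr0.
  near=> h; rewrite gx.
  have <- : (f \o shift x - (cst (f x) + 'd f x)) h =
            (g \o shift x - (cst (f x) + 'd f x)) h.
    by rewrite !fctE /=; congr (_ - _); near: h.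
  by near: h.
apply/diff_locallyP; rewrite (diff_unique dfc H); split=> //.
Unshelve. all: by end_near. Qed.

Section Ck_theory.
Variables (m : nat).
Local Notation V := 'rV[R]_m.
Implicit Types (U : set V) (W : normedModType R).

Lemma Ck_sub W k U U' (f : V -> W) : U' `<=` U -> Ck k U f -> Ck k U' f.
Proof.
move=> UU; elim: k f => [|k IH] f /=; first by move=> h x /UU; apply: h.
by case=> h1 h2; split=> [x /UU /h1|v] //; apply: IH.
Qed.

Lemma Ck_eq W k U (f g : V -> W) : open U -> (forall x, U x -> f x = g x) ->
  Ck k U f -> Ck k U g.
Proof.
move=> oU; have nearU (P : V -> Prop) : (forall x, U x -> P x) ->
    forall x, U x -> \near x, P x.
  by move=> h x Ux; apply: filterS h _; apply: open_nbhs_nbhs.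
elim: k f g => [|k IH] f g fg /=.
  move=> h x Ux; rewrite /prop_for /continuous_at -(fg _ Ux).
  apply: cvg_trans (h x Ux).
  apply: (@near_eq_cvg _ _ (nbhs x) _ f g).
  exact: (nearU (fun y => f y = g y)).
case=> h1 h2; split=> [x Ux|v].
  by apply: near_eq_differentiable (h1 x Ux); apply: nearU Ux => y /fg.
apply: IH (h2 v) => x Ux.
by apply: near_eq_derive; apply: nearU Ux => y /fg.
Qed.

Lemma CkS W k U (f : V -> W) : Ck k.+1 U f -> Ck k U f.
Proof.
elim: k f => [|k IH] f.
  by case=> h _ x Ux; apply: differentiable_continuous; apply: h.
by case=> h1 h2; split=> // v; apply: IH; apply: h2.
Qed.

Lemma Ck_cst W k U (w : W) : Ck k U (fun=> w).
Proof.
elim: k w => [|k IH] w /=; first by move=> x _; apply: cst_continuous.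
split=> [x _|v]; first exact: differentiable_cst.
rewrite (_ : 'D_v _ = fun=> 0); first exact: IH.
by apply/funext => x; exact: derive_cst.
Qed.

Lemma CkD W k U (f g : V -> W) : open U -> Ck k U f -> Ck k U g ->
  Ck k U (fun x => f x + g x).
Proof.
move=> oU; elim: k f g => [|k IH] f g /=.
  by move=> hf hg x Ux; apply: continuousD; [apply: hf|apply: hg].
move=> [f1 f2] [g1 g2]; split=> [x Ux|v].
  by apply: differentiableD; [apply: f1|apply: g1].
apply: Ck_eq (IH _ _ (f2 v) (g2 v)) => // x Ux.
by rewrite -deriveD //; apply: diff_derivable; [apply: f1|apply: g1].
Qed.

Lemma Ck_sum W k U n (f : 'I_n -> V -> W) : open U ->
  (forall i, Ck k U (f i)) -> Ck k U (fun x => \sum_(i < n) f i x).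
Proof.
move=> oU; elim: n f => [|n IH] f hf.
  by apply: Ck_eq (Ck_cst _ _ 0) => // x _; rewrite big_ord0.
apply: (@Ck_eq _ _ _ (fun x => (\sum_(i < n) f (widen_ord (leqnSn n) i) x)
   + f ord_max x)) => // [x _|]; first by rewrite big_ord_recr.
by apply: CkD => //; apply: IH.
Qed.

Lemma CkM k U (f g : V -> R) : open U -> Ck k U f -> Ck k U g ->
  Ck k U (fun x => f x * g x).
Proof.
move=> oU; elim: k f g => [|k IH] f g.
  by move=> hf hg x Ux; apply: continuousM; [apply: hf|apply: hg].
move=> Cf Cg; have /CkS Cf' := Cf; have /CkS Cg' := Cg.
case: Cf Cg => [f1 f2] [g1 g2]; split=> [x Ux|v].
  by apply: differentiableM; [apply: f1|apply: g1].
apply: (@Ck_eq _ _ _ (fun x => f x * 'D_v g x + 'D_v f x * g x)) => // [x Ux|].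
  rewrite -[RHS]/('D_v (f * g) x) deriveM; last 2 first.
  - by apply: diff_derivable; apply: f1.
  - by apply: diff_derivable; apply: g1.
  by rewrite /GRing.scale /= [g x * _]mulrC.
by apply: CkD => //; apply: IH => //; [apply: g2|apply: f2].
Qed.

Lemma Ck_lin W W' (L : {linear W -> W'}) k U (f : V -> W) : continuous L ->
  open U -> Ck k U f -> Ck k U (fun x => L (f x)).
Proof.
move=> cL oU; elim: k f => [|k IH] f.
  by move=> hf x Ux; apply: continuous_comp; [apply: hf|apply: cL].
have dL y : differentiable L y by apply: linear_differentiable.
case=> [f1 f2]; split=> [x Ux|v].
  by apply: differentiable_comp => //; apply: f1.
apply: Ck_eq (IH _ (f2 v)) => // x Ux.
have df := f1 x Ux.
rewrite deriveE // -[RHS]/('D_v (L \o f) x) deriveE; last exact: differentiable_comp.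
by rewrite (@diff_comp _ _ _ _ f L) //= diff_lin.
Qed.

Lemma Ck_coord n k U (f : V -> 'rV[R]_n) (l : 'I_n) : open U -> Ck k U f ->
  Ck k U (fun x => f x 0 l).
Proof.
have lin : linear (fun v : 'rV[R]_n => v 0 l : R) by move=> a u v; rewrite !mxE.
pose L : {linear 'rV[R]_n -> R} :=
  HB.pack (fun v : 'rV[R]_n => v 0 l : R) (GRing.isLinear.Build _ _ _ _ _ lin).
by move=> oU; apply: (@Ck_lin _ _ L) => //; apply: coord_continuous.
Qed.

Lemma Ck_row n k U (f : V -> 'rV[R]_n) : open U ->
  (forall l, Ck k U (fun x => f x 0 l)) -> Ck k U f.
Proof.
move=> oU h.
apply: (@Ck_eq _ _ _ (fun x => \sum_l f x 0 l *: delta_mx 0 l)) => //.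
  by move=> x _; rewrite [RHS]row_sum_delta.
apply: Ck_sum => // l.
have lin : linear (fun a : R => a *: delta_mx 0 l : 'rV[R]_n).
  by move=> a u v; rewrite scalerDl scalerA.
pose L : {linear R -> 'rV[R]_n} := HB.pack (fun a : R => a *: delta_mx 0 l : 'rV[R]_n)
  (GRing.isLinear.Build _ _ _ _ _ lin).
by apply: (@Ck_lin _ _ L) => // x; exact: scalel_continuous.
Qed.

End Ck_theory.

Lemma diff_comp_at (U V W : normedModType R) (g : U -> V) (f : V -> W) x y :
  g x = y -> differentiable g x -> differentiable f y ->
  differentiable (f \o g) x /\ 'd (f \o g) x = 'd f y \o 'd g x :> (U -> W).
Proof.
move=> <- dg df; split; first exact: differentiable_comp.
exact: (@diff_comp _ _ _ _ g f).
Qed.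

Lemma derive_coordE m n (f : 'rV[R]_n -> R) (g : 'rV[R]_m -> 'rV[R]_n) x v :
  differentiable g x -> differentiable f (g x) ->
  'D_v (f \o g) x = \sum_l 'D_v g x 0 l * 'D_(delta_mx 0 l) f (g x).
Proof.
move=> dg df; rewrite deriveE; last exact: differentiable_comp.
rewrite (@diff_comp _ _ _ _ g f) //= -(deriveE v dg).
set w := derive _ _ _; rewrite {1}(row_sum_delta w) linear_sum.
by apply: eq_bigr => l _; rewrite linearZ -(deriveE _ df).
Qed.

Lemma Ck_comp m n k (U : set 'rV[R]_m) (U' : set 'rV[R]_n)
    (f : 'rV[R]_n -> R) (g : 'rV[R]_m -> 'rV[R]_n) :
  open U -> open U' -> (forall x, U x -> U' (g x)) ->
  Ck k U' f -> Ck k U g -> Ck k U (f \o g).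
Proof.
move=> oU oU' UU'; elim: k f g UU' => [|k IH] f g UU'.
  by move=> hf hg x Ux; apply: continuous_comp; [apply: hg|apply/hf/UU'].
move=> [f1 f2] Cg; have /CkS Cg' := Cg; case: Cg => g1 g2.
split=> [x Ux|v].
  by apply: differentiable_comp; [apply: g1|apply/f1/UU'].
apply: (@Ck_eq _ _ _ _
  (fun x => \sum_l 'D_v g x 0 l * 'D_(delta_mx 0 l) f (g x))) => // [x Ux|].
  by rewrite derive_coordE //; [apply: g1|apply/f1/UU'].
apply: Ck_sum => // l; apply: CkM => //; first exact: (Ck_coord l oU (g2 v)).
exact: (IH _ _ UU' (f2 _) Cg').
Qed.

End Calculus.

(* A Hausdorff second-countable space with a smooth atlas (not assumed to be
   maximal). [param i] is the inverse of the chart [coord i]; only its values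
   on the open set [coord i @` dom i] matter. *)
Record manifold (R : realType) (n : nat) := Manifold {
  carrier :> topologicalType;
  chart : Type;
  dom : chart -> set carrier;
  coord : chart -> carrier -> 'rV[R]_n;
  param : chart -> 'rV[R]_n -> carrier;
  manifold_hausdorff : hausdorff_space carrier;
  manifold_countable : @second_countable carrier;
  dom_open : forall i, open (dom i);
  dom_cover : forall p, exists i, dom i p;
  coordK : forall i p, dom i p -> param i (coord i p) = p;
  coord_open : forall i, open (coord i @` dom i);
  coord_cont : forall i p, dom i p -> {for p, continuous (coord i)};
  param_cont : forall i x, (coord i @` dom i) x -> {for x, continuous (param i)};
  transition_smooth : forall i j,
    smooth_on (coord i @` (dom i `&` dom j)) (coord j \o param i)
}.
Arguments dom {R n m} i.
Arguments coord {R n m} i.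
Arguments param {R n m} i.

Section Tangent.
Variables (R : realType) (n : nat) (M : manifold R n).

(* f is C^infinity on the open subset U of M *)
Definition smooth (W : normedModType R) (U : set M) (f : M -> W) : Prop :=
  forall i : chart M, smooth_on (coord i @` (U `&` dom i)) (f \o param i).

Definition chart_at (p : M) : chart M := projT1 (cid (dom_cover p)).

Lemma chart_atP (p : M) : dom (chart_at p) p.
Proof. exact: projT2 (cid (dom_cover p)). Qed.

(* A tangent vector at p is the family of its components in all charts around p
   (0 for the other charts), related by the differentials of the transition
   maps. *)
Definition is_tangent (p : M) (v : chart M -> 'rV[R]_n) : Prop :=
  (forall i, ~ dom i p -> v i = 0) /\
  (forall i j, dom i p -> dom j p ->
     v j = 'd (coord j \o param i) (coord i p) (v i)).

Definition tangent_pred (p : M) : {pred (chart M -> 'rV[R]_n)} :=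
  fun v => `[< is_tangent p v >].

Lemma tangent_pred_submod p : submod_closed (tangent_pred p).
Proof.
split; first by apply/asboolP; split=> // i j _ _; rewrite linear0.
move=> a u v /asboolP[u0 uE] /asboolP[v0 vE]; apply/asboolP; split=> [i ip|i j ip jp].
  by rewrite !fctE u0 // v0 // scaler0 addr0.
by rewrite !fctE linearP -uE // -vE.
Qed.
HB.instance Definition _ p :=
  GRing.isSubmodClosed.Build R (chart M -> 'rV[R]_n) (tangent_pred p)
    (tangent_pred_submod p).

Record tangent_space (p : M) := TangentVector {
  tcomp :> chart M -> 'rV[R]_n;
  _ : tcomp \in tangent_pred p
}.
HB.instance Definition _ p := [isSub of tangent_space p for (@tcomp p)].
HB.instance Definition _ p := [Choice of tangent_space p by <:].
HB.instance Definition _ p := [SubChoice_isSubLmodule of tangent_space p by <:].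

Lemma tangentE p (v : tangent_space p) i j : dom i p -> dom j p ->
  v j = 'd (coord j \o param i) (coord i p) (v i).
Proof. by case: v => v /= /asboolP[_ vE]; apply: vE. Qed.

Lemma tangent0 p (v : tangent_space p) i : ~ dom i p -> v i = 0.
Proof. by case: v => v /= /asboolP[vE _]; apply: vE. Qed.

Lemma chart_image_open i (U : set M) : open U -> open (coord i @` (U `&` dom i)).
Proof.
move=> oU; rewrite openE => _ [p [Up ip] <-].
have Vp : (coord i @` dom i) (coord i p) by exists p.
have h1 : nbhs (coord i p) (coord i @` dom i).
  by apply: open_nbhs_nbhs; split=> //; apply: coord_open.
have h2 : nbhs (coord i p) (param i @^-1` U).
  have := param_cont Vp; rewrite /prop_for /continuous_at coordK // => h2.
  by apply: h2; apply: open_nbhs_nbhs.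
apply: filterS2 h1 h2 => _ [q iq <-] /=.
by rewrite coordK // => Uq; exists q.
Qed.

Lemma overlap_open i j : open (coord i @` (dom i `&` @dom _ _ M j)).
Proof. by rewrite setIC; apply: chart_image_open; apply: dom_open. Qed.

Lemma transition_differentiable i j p : dom i p -> dom j p ->
  differentiable (@coord _ _ M j \o param i) (coord i p).
Proof. by move=> ip jp; apply: (transition_smooth i j 1).1; exists p. Qed.

Lemma transition_id i p : dom i p ->
  'd (@coord _ _ M i \o param i) (coord i p) = id :> ('rV[R]_n -> 'rV[R]_n).
Proof.
move=> ip; apply/funext => w.
rewrite -deriveE; last exact: transition_differentiable.
rewrite -[RHS](derive_id (coord i p) w); apply: near_eq_derive.
have h : nbhs (coord i p) (coord i @` @dom _ _ M i).
  by apply: open_nbhs_nbhs; split; [apply: coord_open|exists p].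
by apply: filterS h => _ [q iq <-] /=; rewrite coordK.
Qed.

Lemma transition_comp i j k p : dom i p -> dom j p -> dom k p ->
  'd (@coord _ _ M k \o param i) (coord i p) =
  'd (coord k \o param j) (coord j p) \o 'd (coord j \o param i) (coord i p)
  :> ('rV[R]_n -> 'rV[R]_n).
Proof.
move=> ip jp kp; apply/funext => w.
have dij := transition_differentiable ip jp.
have djk := transition_differentiable jp kp.
rewrite -deriveE; last exact: transition_differentiable.
have E : (coord j \o param i) (coord i p) = coord j p by rewrite /= coordK.
have [dc <-] := diff_comp_at E dij djk.
rewrite -deriveE //.
apply: near_eq_derive.
have h : nbhs (coord i p) (coord i @` (dom i `&` @dom _ _ M j)).
  by apply: open_nbhs_nbhs; split; [apply: overlap_open|exists p].
by apply: filterS h => _ [q [iq jq] <-] /=; rewrite !coordK.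
Qed.

Lemma tangent_surj i p w : dom i p -> exists v : tangent_space p, v i = w.
Proof.
move=> ip.
pose v j := if `[< dom j p >] then 'd (coord j \o param i) (coord i p) w else 0.
have vP : v \in tangent_pred p.
  apply/asboolP; split=> [j jp|j k jp kp]; rewrite /v.
    by rewrite asboolF.
  rewrite (asboolT kp) (asboolT jp).
  exact: (congr1 (fun f => f w) (transition_comp ip jp kp)).
exists (TangentVector vP) => /=.
rewrite /v (asboolT ip).
exact: (congr1 (fun f => f w) (transition_id ip)).
Qed.

Lemma tangent_inj i p : dom i p -> injective (fun v : tangent_space p => v i).
Proof.
move=> ip u v uv; apply: val_inj; apply/funext => j /=.
have [jp|jp] := pselect (dom j p); last by rewrite !tangent0.
by rewrite (tangentE u ip jp) (tangentE v ip jp) uv.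
Qed.

Lemma tangent_vect_axiom p : Vector.axiom n (tangent_space p).
Proof.
exists (fun v : tangent_space p => tcomp v (chart_at p)); first by move=> a u v.
have s w := cid (tangent_surj w (chart_atP p)).
exists (fun w => projT1 (s w)) => [v|w]; last exact: projT2 (s w).
by apply: (tangent_inj (chart_atP p)); apply: projT2 (s _).
Qed.
HB.instance Definition _ p :=
  Lmodule_hasFinDim.Build R (tangent_space p) (tangent_vect_axiom p).

End Tangent.

(* A vector bundle as a family of fibers with local trivializations
   E_p ~ R^r over an open cover, linear on the fibers, with smooth transition
   functions; these determine the topology and smooth structure of the total
   space. *)
Record vector_bundle (R : realType) (n : nat) (M : manifold R n) (r : nat) :=
  VectorBundle {
  fiber :> M -> vectType R;
  triv : Type;
  triv_dom : triv -> set M;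
  triv_map : forall (a : triv) (p : M), 'Hom(fiber p, 'rV[R]_r);
  triv_open : forall a, open (triv_dom a);
  triv_cover : forall p, exists a, triv_dom a p;
  triv_bij : forall a p, triv_dom a p -> bijective (triv_map a p);
  triv_smooth : forall a b (w : 'rV[R]_r),
    smooth (triv_dom a `&` triv_dom b)
      (fun p => triv_map b p ((triv_map a p)^-1%VF w))
}.
Arguments triv_dom {R n M r v} a.
Arguments triv_map {R n M r v} a p.

Section Bundles.
Variables (R : realType) (n : nat) (M : manifold R n).

Lemma bij_lker0 (V W : vectType R) (f : 'Hom(V, W)) :
  bijective f -> lker f == 0%VS.
Proof. by move=> bf; apply/lker0P/bij_inj. Qed.

Lemma bij_lfunK (V W : vectType R) (f : 'Hom(V, W)) :
  bijective f -> cancel f f^-1%VF.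
Proof. by move=> bf; apply/lker0_lfunK/bij_lker0. Qed.

Lemma bij_lfunVK (V W : vectType R) (f : 'Hom(V, W)) :
  bijective f -> cancel f^-1%VF f.
Proof.
move=> bf w; have [g _ gK] := bf.
by rewrite -[w]gK (bij_lfunK bf).
Qed.

Lemma smooth_eq (W : normedModType R) (U : set M) (f g : M -> W) :
  open U -> (forall p, U p -> f p = g p) -> smooth U f -> smooth U g.
Proof.
move=> oU fg sf i k; apply: Ck_eq (sf i k); first exact: chart_image_open.
by move=> _ [p [Up ip] <-] /=; rewrite coordK // fg.
Qed.

Lemma smooth_coord m (U : set M) (f : M -> 'rV[R]_m) l : open U ->
  smooth U f -> smooth U (fun p => f p 0 l : R).
Proof.
by move=> oU sf i k; apply: Ck_coord (sf i k); apply: chart_image_open.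
Qed.

Lemma smooth_row m (U : set M) (f : M -> 'rV[R]_m) : open U ->
  (forall l, smooth U (fun p => f p 0 l : R)) -> smooth U f.
Proof.
move=> oU sf i k; apply: Ck_row; first exact: chart_image_open.
by move=> l; apply: (sf l i k).
Qed.

Lemma smooth_sum (U : set M) m (f : 'I_m -> M -> R) : open U ->
  (forall l, smooth U (f l)) -> smooth U (fun p => \sum_l f l p).
Proof.
move=> oU sf i k; apply: Ck_sum; first exact: chart_image_open.
by move=> l; apply: (sf l i k).
Qed.

Lemma smoothM (U : set M) (f g : M -> R) : open U ->
  smooth U f -> smooth U g -> smooth U (fun p => f p * g p).
Proof.
move=> oU sf sg i k.
by apply: CkM; [exact: chart_image_open|apply: sf|apply: sg].
Qed.

Lemma smooth_cst (W : normedModType R) (U : set M) (w : W) : smooth U (fun=> w).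
Proof. by move=> i k; apply: Ck_cst. Qed.

Lemma smooth_sub (W : normedModType R) (U U' : set M) (f : M -> W) :
  U' `<=` U -> smooth U f -> smooth U' f.
Proof.
move=> UU sf i k; apply: Ck_sub (sf i k).
by move=> _ [p [/UU Up ip] <-]; exists p.
Qed.

Section TangentBundle.

Definition tangent_coord (i : chart M) (p : M) : 'Hom(tangent_space p, 'rV[R]_n) :=
  linfun (fun v : tangent_space p => v i).

Lemma tangent_coordE i p v : tangent_coord i p v = v i.
Proof.
have lin : linear (fun v : tangent_space p => v i) by move=> a u w.
pose L : {linear tangent_space p -> 'rV[R]_n} :=
  HB.pack (fun v : tangent_space p => v i) (GRing.isLinear.Build _ _ _ _ _ lin).
exact: (lfunE L).
Qed.

Lemma tangent_coord_bij i p : dom i p -> bijective (tangent_coord i p).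
Proof.
move=> ip; have s w := cid (tangent_surj w ip).
exists (fun w => projT1 (s w)) => [v|w]; last first.
  by rewrite tangent_coordE; exact: projT2 (s w).
apply: (tangent_inj ip) => /=; rewrite (projT2 (s _)).
by rewrite tangent_coordE.
Qed.

Lemma tangent_coord_smooth i j w :
  smooth (dom i `&` dom j) (fun p => tangent_coord j p ((tangent_coord i p)^-1%VF w)).
Proof.
have oij : open (dom i `&` @dom _ _ M j) by apply: openI; apply: dom_open.
apply: (@smooth_eq _ _ (fun p => 'D_w (coord j \o param i) (coord i p))) => //.
  move=> p [ip jp]; rewrite tangent_coordE (tangentE _ ip jp).
  rewrite -tangent_coordE (bij_lfunVK (tangent_coord_bij ip)).
  by rewrite deriveE //; apply: transition_differentiable.
apply: smooth_row => // l k m.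
apply: (@Ck_comp _ _ _ _ _ (coord i @` (dom i `&` @dom _ _ M j))
  (fun x => 'D_w (coord j \o param i) x 0 l) (coord i \o param k)).
- exact: chart_image_open.
- exact: overlap_open.
- by move=> _ [p [[ip jp] kp] <-]; exists p => //=; rewrite coordK.
- apply: Ck_coord; first exact: overlap_open.
  exact: (transition_smooth i j m.+1).2.
- apply: Ck_sub (transition_smooth k i m).
  by move=> _ [p [[ip jp] kp] <-]; exists p.
Qed.

Definition tangent_bundle : vector_bundle M n :=
  @VectorBundle R n M n (fun p => tangent_space p : vectType R) (chart M)
    (@dom R n M) tangent_coord (@dom_open _ _ M) (@dom_cover _ _ M)
    tangent_coord_bij tangent_coord_smooth.

End TangentBundle.

Section DualBundle.
Variables (r : nat) (E : vector_bundle M r).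

Definition dual_triv (a : triv E) (p : M) : 'Hom('Hom(E p, R^o), 'rV[R]_r) :=
  linfun (fun alpha : 'Hom(E p, R^o) =>
    \row_k (alpha ((triv_map a p)^-1%VF (delta_mx 0 k)) : R)).

Lemma dual_trivE a p alpha :
  dual_triv a p alpha = \row_k (alpha : 'Hom(E p, R^o)) ((triv_map a p)^-1%VF (delta_mx 0 k)).
Proof.
pose f (alpha : 'Hom(E p, R^o)) : 'rV[R]_r :=
  \row_k alpha ((triv_map a p)^-1%VF (delta_mx 0 k)).
have lin : linear f by move=> c u v; apply/rowP => k; rewrite !mxE !lfunE /= !lfunE.
pose L : {linear 'Hom(E p, R^o) -> 'rV[R]_r} :=
  HB.pack f (GRing.isLinear.Build _ _ _ _ _ lin).
exact: (lfunE L).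
Qed.

Definition dual_triv_inv (a : triv E) (p : M) (w : 'rV[R]_r) : 'Hom(E p, R^o) :=
  linfun (fun X => (\sum_k triv_map a p X 0 k * w 0 k : R^o)).

Lemma dual_triv_invE a p w X :
  dual_triv_inv a p w X = \sum_k triv_map a p X 0 k * w 0 k.
Proof.
pose f (X : E p) : R^o := \sum_k triv_map a p X 0 k * w 0 k.
have lin : linear f.
  move=> c u v; rewrite /f scaler_sumr -big_split; apply: eq_bigr => k _ /=.
  by rewrite linearP !mxE mulrDl -mulrA.
pose L : {linear E p -> R^o} := HB.pack f (GRing.isLinear.Build _ _ _ _ _ lin).
exact: (lfunE L).
Qed.

Lemma dual_trivK a p : triv_dom a p -> cancel (dual_triv_inv a p) (dual_triv a p).
Proof.
move=> ap w; apply/rowP => k; rewrite dual_trivE mxE dual_triv_invE.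
rewrite (bij_lfunVK (triv_bij ap)) (bigD1 k) //= big1 => [|l lk].
  by rewrite mxE !eqxx mul1r addr0.
by rewrite mxE (negbTE lk) andbF mul0r.
Qed.

Lemma dual_triv_bij a p : triv_dom a p -> bijective (dual_triv a p).
Proof.
move=> ap; exists (dual_triv_inv a p); last exact: dual_trivK.
move=> alpha; apply/lfunP => X; rewrite dual_triv_invE dual_trivE.
rewrite -[in RHS](bij_lfunK (triv_bij ap) X) {2}(row_sum_delta (triv_map a p X)).
rewrite !linear_sum; apply: eq_bigr => k _.
by rewrite !linearZ mxE.
Qed.

Lemma dual_triv_smooth a b w : smooth (triv_dom a `&` triv_dom b)
  (fun p => dual_triv b p ((dual_triv a p)^-1%VF w)).
Proof.
have oab : open (triv_dom a `&` @triv_dom _ _ _ _ E b).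
  by apply: openI; apply: triv_open.
apply: smooth_row => // l.
apply: (@smooth_eq _ _ (fun p => \sum_k
  triv_map a p ((triv_map b p)^-1%VF (delta_mx 0 l)) 0 k * w 0 k)) => //.
  move=> p [ap bp].
  have -> : (dual_triv a p)^-1%VF w = dual_triv_inv a p w.
    by rewrite -[in LHS](dual_trivK ap w) (bij_lfunK (dual_triv_bij ap)).
  by rewrite dual_trivE mxE dual_triv_invE.
apply: smooth_sum => // k; apply: smoothM => //; last exact: smooth_cst.
by apply: smooth_coord => //; rewrite setIC; apply: triv_smooth.
Qed.

Definition dual_bundle : vector_bundle M r :=
  @VectorBundle R n M r (fun p => 'Hom(E p, R^o) : vectType R) (triv E)
    (@triv_dom _ _ _ _ E) dual_triv (@triv_open _ _ _ _ E) (@triv_cover _ _ _ _ E)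
    dual_triv_bij dual_triv_smooth.

End DualBundle.

Section SumBundle.
Variables (r s : nat) (E : vector_bundle M r) (F : vector_bundle M s).

Definition sum_triv (c : triv E * triv F) (p : M) :
    'Hom((E p * F p)%type, 'rV[R]_(r + s)) :=
  linfun (fun u : E p * F p =>
    row_mx (triv_map c.1 p u.1) (triv_map c.2 p u.2)).

Lemma sum_trivE c p u :
  sum_triv c p u = row_mx (triv_map c.1 p u.1) (triv_map c.2 p u.2).
Proof.
pose f (u : E p * F p) : 'rV[R]_(r + s) :=
  row_mx (triv_map c.1 p u.1) (triv_map c.2 p u.2).
have lin : linear f by move=> a x y; rewrite /f /= !linearP scale_row_mx add_row_mx.
pose L : {linear (E p * F p)%type -> 'rV[R]_(r + s)} :=
  HB.pack f (GRing.isLinear.Build _ _ _ _ _ lin).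
exact: (lfunE L).
Qed.

Definition sum_dom (c : triv E * triv F) : set M := triv_dom c.1 `&` triv_dom c.2.

Lemma sum_open c : open (sum_dom c).
Proof. by apply: openI; apply: triv_open. Qed.

Lemma sum_cover p : exists c, sum_dom c p.
Proof.
by have [a ap] := triv_cover E p; have [b bp] := triv_cover F p; exists (a, b).
Qed.

Definition sum_triv_inv (c : triv E * triv F) (p : M) (w : 'rV[R]_(r + s)) :
    E p * F p :=
  ((triv_map c.1 p)^-1%VF (lsubmx w), (triv_map c.2 p)^-1%VF (rsubmx w)).

Lemma sum_trivK c p : sum_dom c p -> cancel (sum_triv_inv c p) (sum_triv c p).
Proof.
move=> [ap bp] w; rewrite sum_trivE /=.
by rewrite !(bij_lfunVK (triv_bij _)) // hsubmxK.
Qed.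

Lemma sum_triv_bij c p : sum_dom c p -> bijective (sum_triv c p).
Proof.
move=> cp; exists (sum_triv_inv c p); last exact: sum_trivK.
case: cp => ap bp [u v]; rewrite sum_trivE /sum_triv_inv row_mxKl row_mxKr /=.
by rewrite !(bij_lfunK (triv_bij _)).
Qed.

Lemma sum_triv_smooth c d w : smooth (sum_dom c `&` sum_dom d)
  (fun p => sum_triv d p ((sum_triv c p)^-1%VF w)).
Proof.
have ocd : open (sum_dom c `&` sum_dom d) by apply: openI; apply: sum_open.
apply: smooth_row => // l.
apply: (@smooth_eq _ _ (fun p =>
  row_mx (triv_map d.1 p ((triv_map c.1 p)^-1%VF (lsubmx w)))
         (triv_map d.2 p ((triv_map c.2 p)^-1%VF (rsubmx w))) 0 l)) => //.
  move=> p [cp dp].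
  have -> : (sum_triv c p)^-1%VF w = sum_triv_inv c p w.
    by rewrite -[in LHS](sum_trivK cp w) (bij_lfunK (sum_triv_bij cp)).
  by rewrite sum_trivE.
case: (split_ordP l) => k ->.
  apply: (@smooth_eq _ _ (fun p =>
    triv_map d.1 p ((triv_map c.1 p)^-1%VF (lsubmx w)) 0 k)) => //.
    by move=> p _; rewrite row_mxEl.
  apply: smooth_coord => //; apply: smooth_sub (triv_smooth _ _ _).
  by move=> p [[? ?] [? ?]].
apply: (@smooth_eq _ _ (fun p =>
  triv_map d.2 p ((triv_map c.2 p)^-1%VF (rsubmx w)) 0 k)) => //.
  by move=> p _; rewrite row_mxEr.
apply: smooth_coord => //; apply: smooth_sub (triv_smooth _ _ _).
by move=> p [[? ?] [? ?]].
Qed.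

Definition sum_bundle : vector_bundle M (r + s) :=
  @VectorBundle R n M (r + s) (fun p => (E p * F p)%type : vectType R)
    (triv E * triv F)%type sum_dom sum_triv sum_open sum_cover
    sum_triv_bij sum_triv_smooth.

End SumBundle.

End Bundles.

Section Connections.
Variables (R : realType) (n : nat) (M : manifold R n).

Definition smooth_section (r : nat) (E : vector_bundle M r) (s : forall p, E p) : Prop :=
  forall a : triv E, smooth (triv_dom a) (fun p => triv_map a p (s p)).

(* smoothness of a bundle map over id_M, i.e. of its local matrices *)
Definition smooth_hom (r s : nat) (E : vector_bundle M r) (F : vector_bundle M s)
    (f : forall p, 'Hom(E p, F p)) : Prop :=
  forall (a : triv E) (b : triv F) (w : 'rV[R]_r),
    smooth (triv_dom a `&` triv_dom b)
      (fun p => triv_map b p (f p ((triv_map a p)^-1%VF w))).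

Definition vector_field := forall p : M, tangent_space p.

Definition smooth_field (X : vector_field) : Prop :=
  smooth_section (E := tangent_bundle M) X.

(* v f, computed in a chart around p; by the chain rule the choice of the chart
   is immaterial when f is smooth *)
Definition deriv_along (p : M) (v : tangent_space p) (f : M -> R) : R :=
  'D_(v (chart_at p)) (f \o param (chart_at p)) (coord (chart_at p) p).

(* [X, Y]^k = X^i d_i Y^k - Y^i d_i X^k in a chart around p; for smooth X and Y
   the resulting tangent vector does not depend on the chart *)
Definition bracket (X Y : vector_field) : vector_field := fun p =>
  let i := chart_at p in
  let local (Z : vector_field) (x : 'rV[R]_n) : 'rV[R]_n := Z (param i x) i in
  (tangent_coord i p)^-1%VF
    ('D_(X p i) (local Y) (coord i p) - 'D_(Y p i) (local X) (coord i p)).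

Section Connection.
Variables (r : nat) (E : vector_bundle M r).

(* Gamma(S), for a subbundle S of E *)
Definition section_in (S : forall p, {vspace E p}) (s : forall p, E p) : Prop :=
  smooth_section s /\ forall p, s p \in S p.

Definition connection_map := vector_field -> (forall p, E p) -> forall p, E p.

(* nabla is a connection on the subbundle S of E. A map nabla is defined on all
   (possibly non smooth) sections, but only its values at smooth X and at
   s in Gamma(S) are constrained or used. *)
Record is_connection (S : forall p, {vspace E p}) (nabla : connection_map) : Prop :=
  IsConnection {
  connection_section : forall X s, smooth_field X -> section_in S s ->
    section_in S (nabla X s);
  connection_tensorial : forall (f : M -> R) X Y s p,
    smooth setT f -> smooth_field X -> smooth_field Y -> section_in S s ->
    nabla (fun q => f q *: X q + Y q) s p = f p *: nabla X s p + nabla Y s p;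
  connection_additive : forall X s t p,
    smooth_field X -> section_in S s -> section_in S t ->
    nabla X (fun q => s q + t q) p = nabla X s p + nabla X t p;
  connection_leibniz : forall (f : M -> R) X s p,
    smooth setT f -> smooth_field X -> section_in S s ->
    nabla X (fun q => f q *: s q) p =
      deriv_along (X p) f *: s p + f p *: nabla X s p
}.

End Connection.

Section ParaHermitian.
Variables (r : nat) (E : vector_bundle M r).
Variable I : forall p, 'End(E p).

Definition eigenplus (p : M) : {vspace E p} := passmx.leigenspace (I p) 1.
Definition eigenminus (p : M) : {vspace E p} := passmx.leigenspace (I p) (-1).

Definition projplus (p : M) : 'End(E p) := daddv_pi (eigenplus p) (eigenminus p).
Definition projminus (p : M) : 'End(E p) := daddv_pi (eigenminus p) (eigenplus p).

End ParaHermitian.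

(* The metric tau is a bundle map from E to its dual, u |-> tau(u, -). *)
Record para_hermitian (E : vector_bundle M (n + n))
    (tau : forall p, 'Hom(E p, 'Hom(E p, R^o))) (I : forall p, 'End(E p)) : Prop :=
  ParaHermitian {
  metric_smooth : smooth_hom (F := dual_bundle E) tau;
  metric_sym : forall p (u v : E p), tau p u v = tau p v u;
  metric_nondegenerate : forall p (u : E p), (forall v, tau p u v = 0) -> u = 0;
  structure_smooth : smooth_hom I;
  structure_involutive : forall p, (I p \o I p)%VF = \1%VF;
  structure_neq_id : exists p, I p <> \1%VF;
  eigenbundles_rank : forall p, \dim (eigenplus I p) = \dim (eigenminus I p);
  eigenbundles_sum : forall p, (eigenplus I p + eigenminus I p = fullv)%VS;
  eigenbundles_direct : forall p, (eigenplus I p :&: eigenminus I p = 0)%VS;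
  metric_structure : forall p (u v : E p), tau p (I p u) v + tau p u (I p v) = 0
}.

End Connections.

(* The underlying data of a quasi-Codazzi structure; the conditions are in
   [quasi_codazzi] below. The connections nabla^+, nabla^- on E^+, E^- are
   handled as in [is_connection], with E^+, E^- as subbundles of E. *)
Record quasi_codazzi_data (R : realType) (n : nat) (M : manifold R n) :=
  QuasiCodazziData {
  qc_h : forall p : M, 'Hom(tangent_space p, 'Hom(tangent_space p, R^o));
  qc_bundle : vector_bundle M (n + n);
  qc_tau : forall p, 'Hom(qc_bundle p, 'Hom(qc_bundle p, R^o));
  qc_I : forall p, 'End(qc_bundle p);
  qc_Phi : forall p, 'Hom(tangent_space p, qc_bundle p);
  qc_nablap : connection_map qc_bundle;
  qc_nablam : connection_map qc_bundle
}.
Arguments qc_h {R n M} A p : rename.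
Arguments qc_bundle {R n M} A : rename.
Arguments qc_tau {R n M} A p : rename.
Arguments qc_I {R n M} A p : rename.
Arguments qc_Phi {R n M} A p : rename.
Arguments qc_nablap {R n M} A X s p : rename.
Arguments qc_nablam {R n M} A X s p : rename.

Section Structures.
Variables (R : realType) (n : nat) (M : manifold R n).

Section QuasiCodazzi.
Variable A : quasi_codazzi_data M.
Local Notation E := (qc_bundle A).

Definition qc_omega (p : M) (u v : E p) : R := qc_tau A p u (qc_I A p v).

Definition qc_Phip (p : M) : 'Hom(tangent_space p, E p) :=
  (projplus (qc_I A) p \o qc_Phi A p)%VF.
Definition qc_Phim (p : M) : 'Hom(tangent_space p, E p) :=
  (projminus (qc_I A) p \o qc_Phi A p)%VF.

Definition relatively_torsion_free (nabla : connection_map E)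
    (Psi : forall p, 'Hom(tangent_space p, E p)) : Prop :=
  forall (X Y : vector_field M) p, smooth_field X -> smooth_field Y ->
    nabla X (fun q => Psi q (Y q)) p - nabla Y (fun q => Psi q (X q)) p
      - Psi p (bracket X Y p) = 0.

Record quasi_codazzi : Prop := QuasiCodazzi {
  qc_para_hermitian : para_hermitian (qc_tau A) (qc_I A);
  qc_Phi_smooth : smooth_hom (E := tangent_bundle M) (qc_Phi A);
  qc_Phi_rank : forall p, \dim (limg (qc_Phi A p)) = n;
  qc_Phi_lagrangian : forall p u v,
    u \in limg (qc_Phi A p) -> v \in limg (qc_Phi A p) -> qc_omega u v = 0;
  qc_hE : forall p (u v : tangent_space p),
    qc_h A p u v = qc_tau A p (qc_Phi A p u) (qc_Phi A p v);
  qc_nablap_connection : is_connection (eigenplus (qc_I A)) (qc_nablap A);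
  qc_nablam_connection : is_connection (eigenminus (qc_I A)) (qc_nablam A);
  qc_dual : forall X (s t : forall p, E p) p, smooth_field X ->
    section_in (eigenplus (qc_I A)) s -> section_in (eigenminus (qc_I A)) t ->
    deriv_along (X p) (fun q => qc_tau A q (s q) (t q)) =
      qc_tau A p (qc_nablap A X s p) (t p) + qc_tau A p (s p) (qc_nablam A X t p);
  qc_torsion_freep : relatively_torsion_free (qc_nablap A) qc_Phip;
  qc_torsion_freem : relatively_torsion_free (qc_nablam A) qc_Phim
}.

End QuasiCodazzi.

Record quasi_codazzi_iso (A B : quasi_codazzi_data M)
    (F : forall p, 'Hom(qc_bundle A p, qc_bundle B p)) : Prop := QuasiCodazziIso {
  iso_bij : forall p, bijective (F p);
  iso_smooth : smooth_hom F;
  iso_inv_smooth : smooth_hom (fun p => (F p)^-1%VF);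
  iso_Phi : forall p v, F p (qc_Phi A p v) = qc_Phi B p v;
  iso_I : forall p u, F p (qc_I A p u) = qc_I B p (F p u);
  iso_tau : forall p u v, qc_tau A p u v = qc_tau B p (F p u) (F p v);
  iso_nablap : forall X s p, smooth_field X -> section_in (eigenplus (qc_I A)) s ->
    F p (qc_nablap A X s p) = qc_nablap B X (fun q => F q (s q)) p;
  iso_nablam : forall X s p, smooth_field X -> section_in (eigenminus (qc_I A)) s ->
    F p (qc_nablam A X s p) = qc_nablam B X (fun q => F q (s q)) p
}.

Definition quasi_codazzi_isomorphic (A B : quasi_codazzi_data M) : Prop :=
  exists F, @quasi_codazzi_iso A B F.

(* nabla~_X Y = Psi^-1 (nabla_X (Psi Y)), for Psi injective with image the
   subbundle carrying nabla *)
Definition induced_connection (r : nat) (E : vector_bundle M r)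
    (Psi : forall p, 'Hom(tangent_space p, E p)) (nabla : connection_map E) :
    connection_map (tangent_bundle M) :=
  fun X Y p => (Psi p)^-1%VF (nabla X (fun q => Psi q (Y q)) p).

Definition is_induced_connection (r : nat) (E : vector_bundle M r)
    (Psi : forall p, 'Hom(tangent_space p, E p)) (nabla : connection_map E)
    (nt : connection_map (tangent_bundle M)) : Prop :=
  is_connection (E := tangent_bundle M) (fun=> fullv) nt /\
  forall (X Y : vector_field M) p, smooth_field X -> smooth_field Y ->
    Psi p (nt X Y p) = nabla X (fun q => Psi q (Y q)) p.

Section Standard.
Variable h : forall p : M, 'Hom(tangent_space p, 'Hom(tangent_space p, R^o)).
Variables ntp ntm : connection_map (tangent_bundle M).

Definition std_bundle : vector_bundle M (n + n) :=
  sum_bundle (tangent_bundle M) (dual_bundle (tangent_bundle M)).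

Local Notation std_fiber p :=
  (tangent_space p * 'Hom(tangent_space p, R^o))%type.

Definition std_tau (p : M) : 'Hom(std_fiber p, 'Hom(std_fiber p, R^o)) :=
  linfun (fun u : std_fiber p =>
    linfun (fun v : std_fiber p => v.2 u.1 + u.2 v.1 : R^o)).

Lemma std_tauE p (u v : std_fiber p) : std_tau p u v = v.2 u.1 + u.2 v.1.
Proof.
pose f (u v : std_fiber p) : R^o := v.2 u.1 + u.2 v.1.
have lin w : linear (f w).
  by move=> a x y; rewrite /f /= linearP !lfunE /= lfunE /= scalerDr addrACA.
pose L w : {linear std_fiber p -> R^o} :=
  HB.pack (f w) (GRing.isLinear.Build _ _ _ _ _ (lin w)).
have lin2 : linear (fun w => linfun (f w)).
  move=> a x y; apply/lfunP => w.
  rewrite !lfunE /= lfunE /= (lfunE (L _)) (lfunE (L x)) (lfunE (L y)) /= /f.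
  by rewrite /= linearP !lfunE /= lfunE /= scalerDr addrACA.
pose L2 : {linear std_fiber p -> 'Hom(std_fiber p, R^o)} :=
  HB.pack (fun w => linfun (f w)) (GRing.isLinear.Build _ _ _ _ _ lin2).
by rewrite (lfunE L2) /= (lfunE (L u)).
Qed.

Definition std_I (p : M) : 'End(std_fiber p) :=
  linfun (fun u : std_fiber p => (u.1, - u.2) : std_fiber p).

Lemma std_IE p (u : std_fiber p) : std_I p u = (u.1, - u.2).
Proof.
pose f (u : std_fiber p) : std_fiber p := (u.1, - u.2).
have lin : linear f by move=> a x y; rewrite /f /= opprD -scalerN.
pose L : {linear std_fiber p -> std_fiber p} :=
  HB.pack f (GRing.isLinear.Build _ _ _ _ _ lin).
exact: (lfunE L).
Qed.

Definition std_Phi (p : M) : 'Hom(tangent_space p, std_fiber p) :=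
  linfun (fun v : tangent_space p => (v, 2^-1 *: h p v) : std_fiber p).

Lemma std_PhiE p v : std_Phi p v = (v, 2^-1 *: h p v).
Proof.
pose f (v : tangent_space p) : std_fiber p := (v, 2^-1 *: h p v).
have lin : linear f.
  by move=> a x y; rewrite /f linearP scalerDr scalerA [_ * a]mulrC -scalerA.
pose L : {linear tangent_space p -> std_fiber p} :=
  HB.pack f (GRing.isLinear.Build _ _ _ _ _ lin).
exact: (lfunE L).
Qed.

Definition std_nablap (X : vector_field M) (s : forall p : M, std_fiber p) (p : M) :
    std_fiber p :=
  (ntp X (fun q => (s q).1) p, 0).

(* the second component of s is of the form h~(Y), with Y = h~^-1 (s.2) *)
Definition std_nablam (X : vector_field M) (s : forall p : M, std_fiber p) (p : M) :
    std_fiber p :=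
  (0, h p (ntm X (fun q => (h q)^-1%VF (s q).2) p)).

Definition std_data : quasi_codazzi_data M :=
  @QuasiCodazziData R n M h std_bundle std_tau std_I std_Phi std_nablap std_nablam.

End Standard.

End Structures.

(* Main.v *)
Require Import Defs.
From HB Require Import structures.
From mathcomp Require Import all_boot all_order all_algebra.
From mathcomp Require Import boolp classical_sets functions cardinality reals.
From mathcomp Require Import topology normedtype landau derive.
Import Order.TTheory GRing.Theory Num.Theory.
Import numFieldNormedType.Exports.
Local Open Scope classical_set_scope.
Local Open Scope ring_scope.

(** By the Lagrangian condition, tau(Phi+ X, Phi- Y) = tau(Phi- X, Phi+ Y), so
    h(X, Y) = 2 tau(Phi+ X, Phi- Y): the eigenbundles E+ and E- are isotropic,
    tau pairs them, and the isomorphisms Phi+ and Phi- turn this pairing into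
    h / 2. The isomorphism to the standard structure is therefore
    F(u) = (h^-1(2 tau(u, Phi- -)), tau(u, Phi+ -)), which sends
    Phi+ X + Phi- Y to (X, h(Y, -) / 2). It is smooth because h^-1 is, and it
    carries the given structure to the standard one, which is therefore itself
    quasi-Codazzi: all the axioms are invariant under isomorphism. *)

Set Implicit Arguments.
Unset Strict Implicit.
Unset Printing Implicit Defensive.

(** * Locality of the class C^k and reciprocals of C^k functions *)

Section CkLocal.
Variables (R : realType) (m : nat).
Local Notation V := 'rV[R]_m.

(** Each clause of [Ck] is a condition at single points, with derivatives taken in the ambient
    space, so arbitrary sets U' suffice and no openness enters. *)
Lemma Ck_local (W : normedModType R) k (U : set V) (f : V -> W) :
  (forall x, U x -> exists2 U' : set V, U' x & Ck k U' f) -> Ck k U f.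
Proof.
elim: k f => [|k IH] f h /=; first by move=> x /h[U' U'x]; apply.
split=> [x /h[U' U'x [+ _]]|v]; first exact.
by apply: IH => x /h[U' U'x [_ h2]]; exists U' => //; apply: h2.
Qed.

(** The derivative of 1/f along v is -(1/f)^2 D_v f. If f is C^(k+1), then 1/f is C^k by induction,
    so this product is C^k and 1/f is C^(k+1). *)
Lemma CkV k (U : set V) (f : V -> R) : open U -> (forall x, U x -> f x != 0) ->
  Ck k U f -> Ck k U (fun x => (f x)^-1).
Proof.
move=> oU f0; elim: k => [|k IH] Cf.
  by move=> x Ux; apply: continuousV; [apply: f0|apply: Cf].
have /IH CV := CkS Cf; case: Cf => f1 f2; split=> [x Ux|v].
  by apply: differentiableV; [apply: f1|apply: f0].
(* The derivative is written as nested binary products, the sign as the constant -1, so that [CkM]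
   and [Ck_cst] apply. *)
apply: (@Ck_eq _ _ _ _ _
    (fun x => -1 * (((f x)^-1 * (f x)^-1) * 'D_v f x))) => // [x Ux|].
  rewrite deriveV; [|exact: f0|by apply: diff_derivable; apply: f1].
  by rewrite mulN1r /GRing.scale /= mulNr -exprVn expr2.
apply: CkM => //; first exact: Ck_cst.
by apply: CkM => //; [apply: CkM|apply: f2].
Qed.

End CkLocal.

(** * Smooth functions on the manifold, up to inversion of matrix-valued functions *)

Section SmoothFunctions.
Variables (R : realType) (n : nat) (M : manifold R n).
Implicit Types (U : set M).

Lemma smooth_local (W : normedModType R) U (f : M -> W) :
  (forall p, U p -> exists2 U' : set M, U' p & smooth (U `&` U') f) -> smooth U f.
Proof.
move=> h i k; apply: Ck_local => _ [p [Up ip] <-].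
have [U' U'p sf] := h p Up.
by exists (Defs.coord i @` (U `&` U' `&` dom i)); [exists p|apply: sf].
Qed.

Lemma smoothV U (f : M -> R) : open U -> (forall p, U p -> f p != 0) ->
  smooth U f -> smooth U (fun p => (f p)^-1).
Proof.
move=> oU f0 sf i k; apply: CkV; [exact: chart_image_open| |exact: sf].
by move=> _ [p [Up ip] <-]; rewrite /= coordK // f0.
Qed.

Lemma smoothD (W : normedModType R) U (f g : M -> W) : open U ->
  smooth U f -> smooth U g -> smooth U (fun p => f p + g p).
Proof.
by move=> oU sf sg i k; apply: CkD; [exact: chart_image_open|apply: sf|apply: sg].
Qed.

Lemma smooth_bigsum (J : Type) (r : seq J) (P : pred J) U (f : J -> M -> R) : open U ->
  (forall j, smooth U (f j)) -> smooth U (fun p => \sum_(j <- r | P j) f j p).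
Proof.
move=> oU sf; elim: r => [|j r IH].
  by apply: smooth_eq (smooth_cst _ 0) => // p _; rewrite big_nil.
apply: (@smooth_eq _ _ _ _ _ (fun p => (if P j then f j p else 0)
  + \sum_(j <- r | P j) f j p)) => //.
  by move=> p _; rewrite big_cons; case: (P j); rewrite ?add0r.
by apply: smoothD => //; case: (P j) => //; apply: smooth_cst.
Qed.

Lemma smooth_bigprod (J : Type) (r : seq J) (P : pred J) U (f : J -> M -> R) : open U ->
  (forall j, smooth U (f j)) -> smooth U (fun p => \prod_(j <- r | P j) f j p).
Proof.
move=> oU sf; elim: r => [|j r IH].
  by apply: smooth_eq (smooth_cst _ (1 : R)) => // p _; rewrite big_nil.
apply: (@smooth_eq _ _ _ _ _ (fun p => (if P j then f j p else 1)
  * \prod_(j <- r | P j) f j p)) => //.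
  by move=> p _; rewrite big_cons; case: (P j); rewrite ?mul1r.
by apply: smoothM => //; case: (P j) => //; apply: smooth_cst.
Qed.

(** The Leibniz expansion makes the determinant a polynomial in the entries. *)
Lemma smooth_det r U (A : M -> 'M[R]_r) : open U ->
  (forall k l, smooth U (fun p => A p k l : R)) -> smooth U (fun p => \det (A p) : R).
Proof.
move=> oU sA; apply: smooth_bigsum => // s.
by apply: smoothM => //; [apply: smooth_cst|apply: smooth_bigprod].
Qed.

Lemma smooth_adj r U (A : M -> 'M[R]_r) k l : open U ->
  (forall k l, smooth U (fun p => A p k l : R)) -> smooth U (fun p => (\adj (A p)) k l : R).
Proof.
move=> oU sA.
apply: (@smooth_eq _ _ _ _ _ (fun p => cofactor (A p) l k)) => //.
  by move=> p _; rewrite mxE.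
apply: smoothM => //; first exact: smooth_cst.
apply: smooth_det => // a b.
by apply: smooth_eq (sA (lift l a) (lift k b)) => // p _; rewrite !mxE.
Qed.

(** Cramer's rule: the inverse is the adjugate divided by the determinant, which does not vanish on
    U. *)
Lemma smooth_invmx r U (A : M -> 'M[R]_r) k l : open U ->
  (forall p, U p -> A p \in unitmx) ->
  (forall k l, smooth U (fun p => A p k l : R)) ->
  smooth U (fun p => invmx (A p) k l : R).
Proof.
move=> oU uA sA.
apply: (@smooth_eq _ _ _ _ _ (fun p => (\det (A p))^-1 * (\adj (A p)) k l)) => //.
  by move=> p Up; rewrite /invmx uA // [RHS]mxE.
apply: smoothM => //; last exact: smooth_adj.
apply: smoothV => //; last exact: smooth_det.
by move=> p /uA; rewrite unitmxE unitfE.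
Qed.

End SmoothFunctions.

(** * Local sections and smooth bundle maps *)

Section LocalSections.
Variables (R : realType) (n : nat) (M : manifold R n).
Implicit Types (U : set M).

(** Local frames live only on the domain of a trivialization, so smoothness of a section has to be
    expressible over a subset of M. *)
Definition smooth_section_on r (E : vector_bundle M r) U (s : forall p, E p) : Prop :=
  forall a : triv E, smooth (U `&` triv_dom a) (fun p => triv_map a p (s p)).

Section OneBundle.
Variables (r : nat) (E : vector_bundle M r).

Lemma smooth_sectionT (s : forall p, E p) :
  smooth_section s <-> smooth_section_on setT s.
Proof. by split=> h a; have := h a; rewrite setTI. Qed.

Lemma smooth_section_sub U U' (s : forall p, E p) :
  U' `<=` U -> smooth_section_on U s -> smooth_section_on U' s.
Proof. by move=> UU h a; apply: smooth_sub (h a) => p [/UU]. Qed.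

Lemma smooth_section_eq U (s t : forall p, E p) : open U ->
  (forall p, U p -> s p = t p) -> smooth_section_on U s -> smooth_section_on U t.
Proof.
move=> oU st h a; apply: smooth_eq (h a); first by apply: openI => //; apply: triv_open.
by move=> p [Up _]; rewrite st.
Qed.

Lemma smooth_sectionD U (s t : forall p, E p) : open U ->
  smooth_section_on U s -> smooth_section_on U t ->
  smooth_section_on U (fun p => s p + t p).
Proof.
move=> oU ss st a; have oUa := openI oU (triv_open a).
apply: (@smooth_eq _ _ _ _ _ (fun p => triv_map a p (s p) + triv_map a p (t p))) => //.
  by move=> p _; rewrite linearD.
exact: smoothD.
Qed.

Lemma smooth_sectionM U (f : M -> R) (s : forall p, E p) : open U ->
  smooth U f -> smooth_section_on U s -> smooth_section_on U (fun p => f p *: s p).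
Proof.
move=> oU sf ss a; have oUa := openI oU (triv_open a).
apply: smooth_row => // l.
apply: (@smooth_eq _ _ _ _ _ (fun p => f p * triv_map a p (s p) 0 l)) => //.
  by move=> p _; rewrite linearZ mxE.
apply: smoothM => //; last exact: smooth_coord.
by apply: smooth_sub sf => p [].
Qed.

Lemma smooth_frame (a : triv E) (w : 'rV[R]_r) :
  smooth_section_on (triv_dom a) (fun p => (triv_map a p)^-1%VF w).
Proof. by move=> b; apply: triv_smooth. Qed.

End OneBundle.

(** This turns the smoothness of local matrices into a statement about images of local frames, to
    which the lemmas on sections apply. *)
Lemma smooth_homP r s (E : vector_bundle M r) (F : vector_bundle M s)
    (f : forall p, 'Hom(E p, F p)) :
  smooth_hom f <-> forall (a : triv E) w,
    smooth_section_on (triv_dom a) (fun p => f p ((triv_map a p)^-1%VF w)).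
Proof. by split=> h a; [move=> w b; apply: h|move=> b w; apply: h]. Qed.

Lemma frame_expansion r (E : vector_bundle M r) (a : triv E) p (u : E p) :
  triv_dom a p ->
  u = \sum_k triv_map a p u 0 k *: (triv_map a p)^-1%VF (delta_mx 0 k).
Proof.
move=> ap; rewrite -[LHS](bij_lfunK (triv_bij ap)).
rewrite {1}(row_sum_delta (triv_map a p u)) linear_sum.
by apply: eq_bigr => k _; rewrite linearZ.
Qed.

(** In a local frame the coordinates of f(t) are sums of products of coordinates of t with matrix
    entries of f. *)
Lemma smooth_hom_section r s (E : vector_bundle M r) (F : vector_bundle M s)
    (f : forall p, 'Hom(E p, F p)) U (t : forall p, E p) : open U ->
  smooth_hom f -> smooth_section_on U t -> smooth_section_on U (fun p => f p (t p)).
Proof.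
move=> oU sf st b; apply: smooth_local => p _.
have [a ap] := triv_cover E p; exists (triv_dom a) => //.
have oUba : open (U `&` triv_dom b `&` triv_dom a).
  by apply: openI (triv_open a); apply: openI (triv_open b).
apply: smooth_row => // l.
apply: (@smooth_eq _ _ _ _ _ (fun q => \sum_k triv_map a q (t q) 0 k *
  triv_map b q (f q ((triv_map a q)^-1%VF (delta_mx 0 k))) 0 l)) => //.
  move=> q [[Uq bq] aq]; rewrite [in RHS](frame_expansion (t q) aq) !linear_sum summxE.
  by apply: eq_bigr => k _; rewrite !linearZ mxE.
apply: smooth_sum => // k; apply: smoothM => //.
  by apply: smooth_coord => //; apply: smooth_sub (st a) => q [[]].
by apply: smooth_coord => //; apply: smooth_sub (sf a b _) => q [[]].
Qed.

Lemma smooth_hom_comp r s t (E : vector_bundle M r) (F : vector_bundle M s)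
    (G : vector_bundle M t) (g : forall p, 'Hom(F p, G p)) (f : forall p, 'Hom(E p, F p)) :
  smooth_hom g -> smooth_hom f ->
  smooth_hom (E := E) (F := G) (fun p => (g p \o f p)%VF).
Proof.
move=> sg /smooth_homP sf; apply/smooth_homP => a w.
have := smooth_hom_section (triv_open a) sg (sf a w).
by apply: smooth_section_eq; [exact: triv_open|move=> p _; rewrite comp_lfunE].
Qed.

Lemma smooth_homD r s (E : vector_bundle M r) (F : vector_bundle M s)
    (f g : forall p, 'Hom(E p, F p)) :
  smooth_hom f -> smooth_hom g -> smooth_hom (E := E) (F := F) (fun p => f p + g p).
Proof.
move=> /smooth_homP sf /smooth_homP sg; apply/smooth_homP => a w.
have := smooth_sectionD (triv_open a) (sf a w) (sg a w).
by apply: smooth_section_eq; [exact: triv_open|move=> p _; rewrite lfunE].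
Qed.

Lemma smooth_homZ r s (E : vector_bundle M r) (F : vector_bundle M s) (c : R)
    (f : forall p, 'Hom(E p, F p)) :
  smooth_hom f -> smooth_hom (E := E) (F := F) (fun p => c *: f p).
Proof.
move=> /smooth_homP sf; apply/smooth_homP => a w.
have := smooth_sectionM (triv_open a) (smooth_cst _ c) (sf a w).
by apply: smooth_section_eq; [exact: triv_open|move=> p _; rewrite lfunE].
Qed.

Lemma smooth_hom_id r (E : vector_bundle M r) : smooth_hom (E := E) (fun p => \1%VF).
Proof.
apply/smooth_homP => a w; apply: smooth_section_eq (smooth_frame a w).
  exact: triv_open.
by move=> p _; rewrite lfunE.
Qed.

Lemma smooth_pairing r (E : vector_bundle M r) U (t : forall p, E p)
    (alpha : forall p, dual_bundle E p) : open U ->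
  smooth_section_on (E := dual_bundle E) U alpha -> smooth_section_on U t ->
  smooth U (fun p => alpha p (t p) : R).
Proof.
move=> oU sal st; apply: smooth_local => p _.
have [a ap] := triv_cover E p; exists (triv_dom a) => //.
have oUa := openI oU (triv_open a).
apply: (@smooth_eq _ _ _ _ _ (fun q => \sum_k triv_map a q (t q) 0 k *
  (dual_triv a q (alpha q) 0 k))) => //.
  move=> q [Uq aq]; rewrite [in RHS](frame_expansion (t q) aq) linear_sum.
  by apply: eq_bigr => k _; rewrite linearZ dual_trivE mxE.
apply: smooth_sum => // k; apply: smoothM => //.
  exact: smooth_coord (st a).
exact: smooth_coord (sal a).
Qed.

(** The coordinates of a covector in [dual_triv] are its values on the frame vectors, so testing on
    local frames is enough. *)
Lemma smooth_dual_section r (E : vector_bundle M r) U (alpha : forall p, dual_bundle E p) :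
  open U ->
  (forall (a : triv E) w,
     smooth (U `&` triv_dom a) (fun p => alpha p ((triv_map a p)^-1%VF w) : R)) ->
  smooth_section_on (E := dual_bundle E) U alpha.
Proof.
move=> oU h a; have oUa := openI oU (triv_open a).
apply: smooth_row => // l; apply: smooth_eq (h a (delta_mx 0 l)) => // p _.
by rewrite /= dual_trivE mxE.
Qed.

Lemma smooth_section_pair r s (E : vector_bundle M r) (F : vector_bundle M s) U
    (u : forall p, E p) (v : forall p, F p) : open U ->
  smooth_section_on U u -> smooth_section_on U v ->
  smooth_section_on (E := sum_bundle E F) U (fun p => (u p, v p)).
Proof.
move=> oU su sv c; have oUc := openI oU (triv_open c).
apply: smooth_row => // l.
apply: (@smooth_eq _ _ _ _ _ (fun p =>
  row_mx (triv_map c.1 p (u p)) (triv_map c.2 p (v p)) 0 l)) => //.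
  by move=> p _; rewrite /= sum_trivE.
case: (split_ordP l) => k ->.
  apply: (@smooth_eq _ _ _ _ _ (fun p => triv_map c.1 p (u p) 0 k)) => //.
    by move=> p _; rewrite row_mxEl.
  by apply: smooth_coord => //; apply: smooth_sub (su c.1) => p [? [? ?]].
apply: (@smooth_eq _ _ _ _ _ (fun p => triv_map c.2 p (v p) 0 k)) => //.
  by move=> p _; rewrite row_mxEr.
by apply: smooth_coord => //; apply: smooth_sub (sv c.2) => p [? [? ?]].
Qed.

(** The local matrix of the fiberwise inverse is the inverse of the local matrix of f, which is
    smooth by Cramer's rule. *)
Lemma smooth_hom_inv r (E F : vector_bundle M r) (f : forall p, 'Hom(E p, F p)) :
  (forall p, bijective (f p)) -> smooth_hom f ->
  smooth_hom (E := F) (F := E) (fun p => (f p)^-1%VF).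
Proof.
move=> bf sf b a w; have oba := openI (triv_open b) (triv_open a).
(* Row-vector convention: the rows of [A p] are the images of the frame vectors, and [A p] acts by
   multiplication on the right. *)
pose A p : 'M[R]_r :=
  \matrix_k triv_map b p (f p ((triv_map a p)^-1%VF (delta_mx 0 k))).
have AE p (v : 'rV[R]_r) : v *m A p = triv_map b p (f p ((triv_map a p)^-1%VF v)).
  rewrite mulmx_sum_row [in RHS](row_sum_delta v) !linear_sum.
  by apply: eq_bigr => k _; rewrite !linearZ rowK.
have fA p v : (triv_dom b `&` triv_dom a) p ->
    triv_map a p ((f p)^-1%VF ((triv_map b p)^-1%VF v)) *m A p = v.
  move=> [bp ap]; rewrite AE (bij_lfunK (triv_bij ap)).
  by rewrite (bij_lfunVK (bf p)) (bij_lfunVK (triv_bij bp)).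
have uA p : (triv_dom b `&` triv_dom a) p -> A p \in unitmx.
  (* [B] is the local matrix of the inverse map; a one-sided inverse of a square matrix makes it a
     unit. *)
  move=> bap; pose B : 'M[R]_r := \matrix_k
    triv_map a p ((f p)^-1%VF ((triv_map b p)^-1%VF (delta_mx 0 k))).
  suff /mulmx1_unit[] : B *m A p = 1%:M by [].
  by apply/row_matrixP => k; rewrite row_mul rowK fA // rowE mulmx1.
apply: smooth_row => // l.
apply: (@smooth_eq _ _ _ _ _ (fun p => \sum_k w 0 k * invmx (A p) k l)) => //.
  move=> p bap; transitivity ((w *m invmx (A p)) 0 l); first by rewrite mxE.
  by rewrite -[in LHS](fA p w bap) mulmxK //; apply: uA.
apply: smooth_sum => // k; apply: smoothM => //; first exact: smooth_cst.
apply: smooth_invmx => // i j.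
apply: (@smooth_eq _ _ _ _ _ (fun p =>
  triv_map b p (f p ((triv_map a p)^-1%VF (delta_mx 0 i))) 0 j)) => //.
  by move=> p _; rewrite !mxE.
apply: smooth_coord => //; apply: smooth_sub (sf a b _).
by move=> p [].
Qed.

End LocalSections.

Lemma scale_half_double (R : numFieldType) (V : lmodType R) (v : V) :
  2^-1 *: (v + v) = v.
Proof. by rewrite -mulr2n -(scaler_nat 2 v) scalerA mulVf ?scale1r ?pnatr_eq0. Qed.

(** * Transport of connections along bundle maps *)

Section Transport.
Variables (R : realType) (n : nat) (M : manifold R n).

Lemma eq_smooth_hom r s (E : vector_bundle M r) (F : vector_bundle M s)
    (f g : forall p, 'Hom(E p, F p)) :
  (forall p, f p =1 g p) -> smooth_hom f -> smooth_hom g.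
Proof.
by move=> fg; have -> : f = g by apply: functional_extensionality_dep => p; apply/lfunP.
Qed.

Lemma section_in_hom r s (E : vector_bundle M r) (F : vector_bundle M s)
    (f : forall p, 'Hom(E p, F p)) (S : forall p, {vspace E p}) (T : forall p, {vspace F p})
    (u : forall p, E p) :
  smooth_hom f -> (forall p v, v \in S p -> f p v \in T p) ->
  section_in S u -> section_in T (fun p => f p (u p)).
Proof.
move=> sf fS [su uS]; split=> [|p]; last exact/fS/uS.
by apply/smooth_sectionT/smooth_hom_section => //; [apply: openT|apply/smooth_sectionT].
Qed.

(* Only the values of [f] on [S] matter, so that this covers both bundle
   isomorphisms and inverses of isomorphisms onto the subbundle [S]. *)
Lemma connection_transport r s (E : vector_bundle M r) (F : vector_bundle M s)
    (f : forall p, 'Hom(E p, F p)) (g : forall p, 'Hom(F p, E p))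
    (S : forall p, {vspace E p}) (T : forall p, {vspace F p})
    (nabla : connection_map E) (nabla' : connection_map F) :
  smooth_hom f -> smooth_hom g ->
  (forall p u, u \in S p -> f p u \in T p) ->
  (forall p v, v \in T p -> g p v \in S p) ->
  (forall p v, v \in T p -> f p (g p v) = v) ->
  (forall X t, smooth_field X -> section_in T t -> forall p,
     nabla' X t p = f p (nabla X (fun q => g q (t q)) p)) ->
  is_connection S nabla -> is_connection T nabla'.
Proof.
move=> sf sg fS gT fgK nE [c1 c2 c3 c4].
have gsec t : section_in T t -> section_in S (fun p => g p (t p)) by apply: section_in_hom.
have Tadd t t' : section_in T t -> section_in T t' -> section_in T (fun p => t p + t' p).
  move=> [st tT] [st' tT']; split=> [|p]; last by rewrite memvD.
  by apply/smooth_sectionT/smooth_sectionD; [apply: openT| |]; apply/smooth_sectionT.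
have Tmul (h : M -> R) t : smooth setT h -> section_in T t ->
    section_in T (fun p => h p *: t p).
  move=> sh [st tT]; split=> [|p]; last by rewrite memvZ.
  by apply/smooth_sectionT/smooth_sectionM => //; [apply: openT|apply/smooth_sectionT].
split.
- move=> X t sX tT.
  have -> : nabla' X t = fun p => f p (nabla X (fun q => g q (t q)) p).
    by apply: functional_extensionality_dep => p; rewrite nE.
  by apply: section_in_hom fS _ => //; apply: c1 => //; apply: gsec.
- move=> h X Y t p sh sX sY tT; rewrite !nE //; last first.
    apply/smooth_sectionT/smooth_sectionD; [exact: openT| |exact/smooth_sectionT].
    by apply: smooth_sectionM => //; [exact: openT|exact/smooth_sectionT].
  by rewrite c2 //; [rewrite linearP|apply: gsec].
- move=> X t t' p sX tT tT'; rewrite !nE //; last exact: Tadd.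
  rewrite -linearD -c3 //; [|exact: gsec|exact: gsec].
  by congr (f p (nabla X _ p)); apply: functional_extensionality_dep => q; rewrite linearD.
- move=> h X t p sh sX tT; rewrite !nE //; last exact: Tmul.
  have -> : (fun q => g q (h q *: t q)) = (fun q => h q *: g q (t q)).
    by apply: functional_extensionality_dep => q; rewrite linearZ.
  rewrite c4 //; last exact: gsec.
  (* The derivative term comes out as a multiple of f (g (t p)), which is t p because t takes values
     in [T]. *)
  by rewrite linearD !linearZ /= fgK //; case: tT.
Qed.

Lemma eigenplusE r (E : vector_bundle M r) (I : forall p, 'End(E p)) p u :
  (u \in eigenplus I p) = (I p u == u).
Proof. by rewrite memv_ker !lfun_simp scale1r subr_eq0. Qed.

Lemma eigenminusE r (E : vector_bundle M r) (I : forall p, 'End(E p)) p u :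
  (u \in eigenminus I p) = (I p u == - u).
Proof. by rewrite memv_ker !lfun_simp scaleN1r opprK addr_eq0. Qed.

(** * Eigenbundle projections and isotropy of the eigenbundles *)

Section ParaHermitianTheory.
Variables (E : vector_bundle M (n + n)).
Variables (tau : forall p, 'Hom(E p, 'Hom(E p, R^o))) (I : forall p, 'End(E p)).
Hypothesis ph : para_hermitian tau I.

Lemma proj_add p u : projplus I p u + projminus I p u = u.
Proof.
by apply: daddv_pi_add; rewrite ?(eigenbundles_direct ph) ?(eigenbundles_sum ph) ?memvf.
Qed.

Lemma projplus_in p u : projplus I p u \in eigenplus I p.
Proof. exact: memv_pi. Qed.

Lemma projminus_in p u : projminus I p u \in eigenminus I p.
Proof. exact: memv_pi. Qed.

(** Expressing the projection as a polynomial in I is what gives its smoothness and its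
    compatibility with maps commuting with I. *)
Lemma projplusE p u : projplus I p u = 2^-1 *: (u + I p u).
Proof.
have /eqP Ip : I p (projplus I p u) == projplus I p u by rewrite -eigenplusE projplus_in.
have /eqP Im : I p (projminus I p u) == - projminus I p u.
  by rewrite -eigenminusE projminus_in.
rewrite -[in RHS](proj_add u) (linearD (I p)) /= Ip Im addrACA subrr addr0.
by rewrite scale_half_double.
Qed.

Lemma projminusE p u : projminus I p u = 2^-1 *: (u - I p u).
Proof.
apply: (addrI (projplus I p u)); rewrite proj_add projplusE -scalerDr addrACA subrr addr0.
by rewrite scale_half_double.
Qed.

Lemma projplus_smooth : smooth_hom (projplus I).
Proof.
apply: (@eq_smooth_hom _ _ E E (fun p => 2^-1 *: (\1%VF + I p))) => [p u|].
  by rewrite projplusE !lfun_simp.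
apply/smooth_homZ/smooth_homD; [exact: smooth_hom_id|exact: structure_smooth ph].
Qed.

Lemma projminus_smooth : smooth_hom (projminus I).
Proof.
apply: (@eq_smooth_hom _ _ E E (fun p => 2^-1 *: (\1%VF + (-1) *: I p))) => [p u|].
  by rewrite projminusE !lfun_simp scaleN1r.
apply/smooth_homZ/smooth_homD; first exact: smooth_hom_id.
exact/smooth_homZ/(structure_smooth ph).
Qed.

(** On eigenvectors for 1 the skewness of I with respect to tau reads 2 tau(u, v) = 0. *)
Lemma metric_plus p u v : u \in eigenplus I p -> v \in eigenplus I p -> tau p u v = 0.
Proof.
rewrite !eigenplusE => /eqP uE /eqP vE; have := metric_structure ph u v.
by rewrite uE vE => /eqP; rewrite -mulr2n mulrn_eq0 => /eqP.
Qed.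

Lemma metric_minus p u v : u \in eigenminus I p -> v \in eigenminus I p -> tau p u v = 0.
Proof.
rewrite !eigenminusE => /eqP uE /eqP vE; have := metric_structure ph u v.
rewrite uE vE !linearN lfunE /= => /eqP.
by rewrite -mulr2n mulrn_eq0 oppr_eq0 => /eqP.
Qed.

End ParaHermitianTheory.

End Transport.

(** * The components of Phi in the two eigenbundles *)

Section PhiComponents.
Variables (R : realType) (n : nat) (M : manifold R n) (A : quasi_codazzi_data M).
Hypothesis HA : quasi_codazzi A.

Local Notation E := (qc_bundle A).
Local Notation T := (tangent_bundle M).
Local Notation Phip := (qc_Phip A).
Local Notation Phim := (qc_Phim A).

Let ph : para_hermitian (qc_tau A) (qc_I A) := qc_para_hermitian HA.

Lemma Phip_in p v : Phip p v \in eigenplus (qc_I A) p.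
Proof. by rewrite comp_lfunE projplus_in. Qed.

Lemma Phim_in p v : Phim p v \in eigenminus (qc_I A) p.
Proof. by rewrite comp_lfunE projminus_in. Qed.

Lemma Phi_split p v : qc_Phi A p v = Phip p v + Phim p v.
Proof. by rewrite !comp_lfunE (proj_add ph). Qed.

Lemma Phip_smooth : smooth_hom (E := T) Phip.
Proof. exact: smooth_hom_comp (projplus_smooth ph) (qc_Phi_smooth HA). Qed.

Lemma Phim_smooth : smooth_hom (E := T) Phim.
Proof. exact: smooth_hom_comp (projminus_smooth ph) (qc_Phi_smooth HA). Qed.

Lemma Phip_section Y : smooth_field Y ->
  section_in (eigenplus (qc_I A)) (fun q => Phip q (Y q)).
Proof.
move=> sY; apply: (section_in_hom (E := T) (S := fun=> fullv)) Phip_smooth _ _.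
  by move=> p v _; apply: Phip_in.
by split=> [|p]; [|rewrite memvf].
Qed.

Lemma Phim_section Y : smooth_field Y ->
  section_in (eigenminus (qc_I A)) (fun q => Phim q (Y q)).
Proof.
move=> sY; apply: (section_in_hom (E := T) (S := fun=> fullv)) Phim_smooth _ _.
  by move=> p v _; apply: Phim_in.
by split=> [|p]; [|rewrite memvf].
Qed.

End PhiComponents.

Arguments Phip_in {R n M A} [p] v.
Arguments Phim_in {R n M A} [p] v.

(** * Invariance of the quasi-Codazzi axioms under isomorphism *)

Section IsoTransport.
Variables (R : realType) (n : nat) (M : manifold R n).
Variables (A B : quasi_codazzi_data M).
Variable F : forall p, 'Hom(qc_bundle A p, qc_bundle B p).
Hypotheses (HA : quasi_codazzi A) (HF : quasi_codazzi_iso F).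
Hypothesis hAB : forall p, qc_h A p = qc_h B p.

Local Notation G := (fun p => (F p)^-1%VF).

Let FK p : cancel (F p) (G p).
Proof. exact/bij_lfunK/(iso_bij HF). Qed.

Let GK p : cancel (G p) (F p).
Proof. exact/bij_lfunVK/(iso_bij HF). Qed.

Let phA : para_hermitian (qc_tau A) (qc_I A) := qc_para_hermitian HA.

Lemma iso_eigenplus p u : (F p u \in eigenplus (qc_I B) p) = (u \in eigenplus (qc_I A) p).
Proof. by rewrite !eigenplusE -(iso_I HF) (inj_eq (can_inj (@FK p))). Qed.

Lemma iso_eigenminus p u :
  (F p u \in eigenminus (qc_I B) p) = (u \in eigenminus (qc_I A) p).
Proof. by rewrite !eigenminusE -(iso_I HF) -linearN (inj_eq (can_inj (@FK p))). Qed.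

Lemma limg_bij_image p (S : {vspace qc_bundle A p}) (T : {vspace qc_bundle B p}) :
  (forall u, (F p u \in T) = (u \in S)) -> (F p @: S)%VS = T.
Proof.
move=> FS; apply/vspaceP => v; rewrite -[v]GK FS.
by rewrite memvE -limg_line limg_ker0 -?memvE //; apply/lker0P/can_inj/FK.
Qed.

Let imgp p : (F p @: eigenplus (qc_I A) p)%VS = eigenplus (qc_I B) p.
Proof. exact/limg_bij_image/iso_eigenplus. Qed.

Let imgm p : (F p @: eigenminus (qc_I A) p)%VS = eigenminus (qc_I B) p.
Proof. exact/limg_bij_image/iso_eigenminus. Qed.

Let kerF p : lker (F p) == 0%VS.
Proof. exact/lker0P/can_inj/FK. Qed.

Let dim_img p (S : {vspace qc_bundle A p}) : \dim (F p @: S) = \dim S.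
Proof. by apply: limg_dim_eq; rewrite (eqP (kerF p)) capv0. Qed.

Let IE p v : qc_I B p v = F p (qc_I A p (G p v)).
Proof. by rewrite (iso_I HF) GK. Qed.

Let tauE p u v : qc_tau B p u v = qc_tau A p (G p u) (G p v).
Proof. by rewrite (iso_tau HF) !GK. Qed.

Lemma para_hermitian_transport : para_hermitian (qc_tau B) (qc_I B).
Proof.
split.
(* Evaluated on two local frames of the target, its metric is [qc_tau A] paired with the pullbacks
   of these frames by the smooth inverse of F. *)
- apply/smooth_homP => a w; apply: smooth_dual_section => [|b w']; first exact: triv_open.
  have oab := openI (triv_open a) (triv_open b).
  pose s p : qc_bundle A p := G p ((triv_map a p)^-1%VF w).
  pose t p : qc_bundle A p := G p ((triv_map b p)^-1%VF w').
  have ss : smooth_section_on (triv_dom a) s.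
    exact: smooth_hom_section (triv_open a) (iso_inv_smooth HF) (smooth_frame a w).
  have st : smooth_section_on (triv_dom b) t.
    exact: smooth_hom_section (triv_open b) (iso_inv_smooth HF) (smooth_frame b w').
  apply: (@smooth_eq _ _ _ _ _ (fun p => qc_tau A p (s p) (t p) : R)) => //.
  apply: (@smooth_pairing _ _ _ _ _ _ t (fun p => qc_tau A p (s p))) => //.
    apply: (smooth_hom_section (F := dual_bundle (qc_bundle A)) oab (metric_smooth phA)).
    by apply: smooth_section_sub ss => p [].
  by apply: smooth_section_sub st => p [].
- by move=> p u v; rewrite !tauE (Defs.metric_sym phA).
- move=> p u u0; rewrite -[u]GK (_ : G p u = 0) ?linear0 //.
  apply: (metric_nondegenerate phA) => v.
  by have := u0 (F p v); rewrite tauE FK.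
- have := smooth_hom_comp (iso_smooth HF)
    (smooth_hom_comp (structure_smooth phA) (iso_inv_smooth HF)).
  by apply: eq_smooth_hom => p v; rewrite IE !comp_lfunE.
- move=> p; apply/lfunP => v; rewrite comp_lfunE !IE FK id_lfunE -[RHS]GK; congr (F p _).
  by rewrite -comp_lfunE (structure_involutive phA) id_lfunE.
- have [p Ip] := structure_neq_id phA; exists p => IB; apply: Ip; apply/lfunP => u.
  by apply: (can_inj (@FK p)); rewrite (iso_I HF) IB !id_lfunE.
- by move=> p; rewrite -imgp -imgm !dim_img (eigenbundles_rank phA).
- move=> p; rewrite -imgp -imgm -limgD (eigenbundles_sum phA).
  by apply/limg_bij_image => u; rewrite !memvf.
- by move=> p; rewrite -imgp -imgm -lker0_img_cap // (eigenbundles_direct phA) limg0.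
- by move=> p u v; rewrite !tauE !IE !FK (metric_structure phA).
Qed.

Let phB := para_hermitian_transport.

(** F commutes with I, and the projection is a polynomial in I, so F also carries the components of
    Phi to each other. *)
Let Phip_E p v : qc_Phip B p v = F p (qc_Phip A p v).
Proof.
rewrite /qc_Phip !comp_lfunE (projplusE phA) (projplusE phB) -(iso_Phi HF) -(iso_I HF).
by rewrite -linearD -linearZ.
Qed.

Let Phim_E p v : qc_Phim B p v = F p (qc_Phim A p v).
Proof.
rewrite /qc_Phim !comp_lfunE (projminusE phA) (projminusE phB) -(iso_Phi HF) -(iso_I HF).
by rewrite -linearB -linearZ.
Qed.

Let secp t : section_in (eigenplus (qc_I B)) t ->
  section_in (eigenplus (qc_I A)) (fun q => G q (t q)).
Proof.
by apply: section_in_hom (iso_inv_smooth HF) _ => p v; rewrite -iso_eigenplus GK.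
Qed.

Let secm t : section_in (eigenminus (qc_I B)) t ->
  section_in (eigenminus (qc_I A)) (fun q => G q (t q)).
Proof.
by apply: section_in_hom (iso_inv_smooth HF) _ => p v; rewrite -iso_eigenminus GK.
Qed.

Let FGK t : (fun q => F q (G q (t q))) = t.
Proof. by apply: functional_extensionality_dep => q; rewrite GK. Qed.

Let nablapE X t : smooth_field X -> section_in (eigenplus (qc_I B)) t ->
  forall p, qc_nablap B X t p = F p (qc_nablap A X (fun q => G q (t q)) p).
Proof. by move=> sX /secp st p; rewrite (iso_nablap HF) // FGK. Qed.

Let nablamE X t : smooth_field X -> section_in (eigenminus (qc_I B)) t ->
  forall p, qc_nablam B X t p = F p (qc_nablam A X (fun q => G q (t q)) p).
Proof. by move=> sX /secm st p; rewrite (iso_nablam HF) // FGK. Qed.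

Lemma quasi_codazzi_transport : quasi_codazzi B.
Proof.
split=> //.
- apply: eq_smooth_hom (smooth_hom_comp (iso_smooth HF) (qc_Phi_smooth HA)) => p v.
  by rewrite comp_lfunE (iso_Phi HF).
(* The Phi of the target is F composed with that of the source, and the injective F preserves
   dimensions. *)
- move=> p; rewrite -[RHS](qc_Phi_rank HA p) -(dim_img (limg (qc_Phi A p))) -limg_comp.
  by congr (\dim (limg _)); apply/lfunP => v; rewrite comp_lfunE (iso_Phi HF).
- move=> p _ _ /memv_imgP[u _ ->] /memv_imgP[v _ ->].
  rewrite /qc_omega -!(iso_Phi HF) -(iso_I HF) -(iso_tau HF).
  by apply: (qc_Phi_lagrangian HA); apply: memv_img; rewrite memvf.
- by move=> p u v; rewrite -hAB (qc_hE HA) (iso_tau HF) !(iso_Phi HF).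
- apply: (connection_transport (iso_smooth HF) (iso_inv_smooth HF) _ _ _ nablapE
    (qc_nablap_connection HA)) => p u.
  + by rewrite iso_eigenplus.
  + by rewrite -iso_eigenplus GK.
  + by rewrite GK.
- apply: (connection_transport (iso_smooth HF) (iso_inv_smooth HF) _ _ _ nablamE
    (qc_nablam_connection HA)) => p u.
  + by rewrite iso_eigenminus.
  + by rewrite -iso_eigenminus GK.
  + by rewrite GK.
- move=> X s t p sX ss st; rewrite nablapE // nablamE // !tauE !FK.
  rewrite -(qc_dual HA p sX (secp ss) (secm st)); congr deriv_along.
  by apply/funext => q; rewrite tauE.
- move=> X Y p sX sY.
  have FE Z : (fun q => qc_Phip B q (Z q)) = (fun q => F q (qc_Phip A q (Z q))).
    by apply: functional_extensionality_dep => q; rewrite Phip_E.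
  rewrite !FE -!(iso_nablap HF) //; try exact: (Phip_section HA).
  by rewrite Phip_E -!linearB (qc_torsion_freep HA) // linear0.
- move=> X Y p sX sY.
  have FE Z : (fun q => qc_Phim B q (Z q)) = (fun q => F q (qc_Phim A q (Z q))).
    by apply: functional_extensionality_dep => q; rewrite Phim_E.
  rewrite !FE -!(iso_nablam HF) //; try exact: (Phim_section HA).
  by rewrite Phim_E -!linearB (qc_torsion_freem HA) // linear0.
Qed.

End IsoTransport.

(** * Fiber dimensions and bijectivity of injective bundle maps of equal rank *)

Section BundleDimension.
Variables (R : realType) (n : nat) (M : manifold R n).

Lemma dim_fiber r (E : vector_bundle M r) p : \dim {: E p} = r.
Proof.
have [a ap] := triv_cover E p; have bij := triv_bij ap.
rewrite -(limg_dim_eq (f := triv_map a p)); last by rewrite (eqP (bij_lker0 bij)) capv0.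
have -> : limg (triv_map a p) = fullv.
  apply/vspaceP => w; rewrite memvf -[w](bij_lfunVK bij).
  by rewrite memv_img ?memvf.
by rewrite dimvf /dim /= mul1n.
Qed.

Lemma lker0_bij r (E F : vector_bundle M r) p (f : 'Hom(E p, F p)) :
  lker f == 0%VS -> bijective f.
Proof.
move=> f0; have fK := lker0_lfunK f0; exists (f^-1%VF) => // w.
apply: limg_lfunVK; suff -> : limg f = fullv by rewrite memvf.
apply/eqP; rewrite eqEdim subvf /= limg_dim_eq ?(eqP f0) ?capv0 //.
by rewrite !dim_fiber.
Qed.

End BundleDimension.

(** * Lowering an index along a map from the tangent bundle *)

Section Flat.
Variables (R : realType) (n : nat) (M : manifold R n) (r : nat) (E : vector_bundle M r).
Variable tau : forall p, 'Hom(E p, 'Hom(E p, R^o)).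
Variable Psi : forall p, 'Hom(tangent_space p, E p).

(** The map u -> tau(u, Psi -), that is, the musical map of tau followed by the transpose of Psi. *)
Definition flat p : 'Hom(E p, 'Hom(tangent_space p, R^o)) :=
  linfun (fun u : E p => (tau p u \o Psi p)%VF).

Lemma flatE p u v : flat p u v = tau p u (Psi p v).
Proof.
have lin : linear (fun u : E p => (tau p u \o Psi p)%VF).
  by move=> a x y; rewrite linearP comp_lfunDl comp_lfunZl.
pose L : {linear E p -> 'Hom(tangent_space p, R^o)} :=
  HB.pack (fun u : E p => (tau p u \o Psi p)%VF) (GRing.isLinear.Build _ _ _ _ _ lin).
by rewrite (lfunE L) /= comp_lfunE.
Qed.

Lemma flat_smooth : smooth_hom (F := dual_bundle E) tau ->
  smooth_hom (E := tangent_bundle M) Psi ->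
  smooth_hom (F := dual_bundle (tangent_bundle M)) flat.
Proof.
move=> stau sPsi; apply/smooth_homP => a w.
apply: smooth_dual_section => [|b w']; first exact: triv_open.
have oab := openI (triv_open a) (triv_open b).
pose alpha p : dual_bundle E p := tau p ((triv_map a p)^-1%VF w).
pose t p : E p := Psi p ((triv_map b p)^-1%VF w').
apply: (@smooth_eq _ _ _ _ _ (fun p => alpha p (t p) : R)) => //.
  by move=> p _; symmetry; exact: flatE.
apply: smooth_pairing => //.
  have := smooth_hom_section (triv_open a) stau (smooth_frame a w).
  by apply: smooth_section_sub => p [].
have := smooth_hom_section (triv_open b) sPsi (smooth_frame b w').
by apply: smooth_section_sub => p [].
Qed.

End Flat.

(** * The pairing of the eigenbundles and non-degeneracy of h *)

Section Proposition.
Variables (R : realType) (n : nat) (M : manifold R n) (A : quasi_codazzi_data M).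
Hypothesis HA : quasi_codazzi A.
Hypothesis Hp : forall p, lker (qc_Phip A p) == 0%VS /\
  limg (qc_Phip A p) = eigenplus (qc_I A) p.
Hypothesis Hm : forall p, lker (qc_Phim A p) == 0%VS /\
  limg (qc_Phim A p) = eigenminus (qc_I A) p.

Local Notation E := (qc_bundle A).
Local Notation T := (tangent_bundle M).
Local Notation tau := (qc_tau A).
Local Notation h := (qc_h A).
Local Notation Phip := (qc_Phip A).
Local Notation Phim := (qc_Phim A).
Local Notation flatp := (flat (qc_tau A) (qc_Phip A)).
Local Notation flatm := (flat (qc_tau A) (qc_Phim A)).

Let ph : para_hermitian tau (qc_I A) := qc_para_hermitian HA.

(** Expand omega(Phi u, Phi v) = 0 along the eigenbundles: isotropy kills the two pure terms, and I
    gives the two mixed terms opposite signs. *)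
Lemma tau_Phi_sym p u v : tau p (Phip p u) (Phim p v) = tau p (Phim p u) (Phip p v).
Proof.
have /eqP Ip : qc_I A p (Phip p v) == Phip p v by rewrite -eigenplusE Phip_in.
have /eqP Im : qc_I A p (Phim p v) == - Phim p v by rewrite -eigenminusE Phim_in.
have := qc_Phi_lagrangian HA (memv_img (qc_Phi A p) (memvf u))
  (memv_img (qc_Phi A p) (memvf v)).
rewrite /qc_omega !(Phi_split HA) (linearD (qc_I A p)) /= Ip Im.
rewrite (linearD (tau p)) add_lfunE /= !linearB /=.
rewrite (metric_plus ph (Phip_in u) (Phip_in v)).
rewrite (metric_minus ph (Phim_in u) (Phim_in v)) sub0r subr0.
by rewrite addrC => /eqP; rewrite subr_eq0 => /eqP.
Qed.

Lemma h_flatm p u : h p u = 2 *: flatm p (Phip p u).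
Proof.
apply/lfunP => v; rewrite (qc_hE HA) !(Phi_split HA) (linearD (tau p)).
rewrite add_lfunE /= !linearD /=.
rewrite (metric_plus ph (Phip_in u) (Phip_in v)).
rewrite (metric_minus ph (Phim_in u) (Phim_in v)) add0r addr0 -tau_Phi_sym.
by rewrite scale_lfunE flatE scaler_nat mulr2n.
Qed.

Lemma h_flatp p u : h p u = 2 *: flatp p (Phim p u).
Proof.
by rewrite h_flatm; congr (_ *: _); apply/lfunP => v; rewrite !flatE tau_Phi_sym.
Qed.

Lemma flatp_plus p u : u \in eigenplus (qc_I A) p -> flatp p u = 0.
Proof.
move=> uE; apply/lfunP => v; rewrite flatE zero_lfunE; exact: (metric_plus ph uE (Phip_in v)).
Qed.

Lemma flatm_minus p u : u \in eigenminus (qc_I A) p -> flatm p u = 0.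
Proof.
move=> uE; apply/lfunP => v; rewrite flatE zero_lfunE; exact: (metric_minus ph uE (Phim_in v)).
Qed.

(** By equality of ranks injectivity is enough. If h(u) = 0, then Phi+ u is orthogonal to E- = im
    Phi- by [h_flatm] and to E+ by isotropy, hence zero, and Phi+ is injective. *)
Lemma h_bij p : bijective (h p).
Proof.
apply: (@lker0_bij _ _ _ _ T (dual_bundle T)).
rewrite -subv0; apply/subvP => u; rewrite memv_ker memv0 => /eqP hu.
rewrite -memv0 -(eqP (Hp p).1) memv_ker; apply/eqP/(metric_nondegenerate ph) => v.
rewrite -(proj_add ph v) linearD /= (metric_plus ph) ?Phip_in ?projplus_in // add0r.
have : projminus (qc_I A) p v \in limg (Phim p) by rewrite (Hm p).2 projminus_in.
case/memv_imgP => w _ ->; have := congr1 (fun f : 'Hom(_, _) => f w) hu.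
rewrite h_flatm scale_lfunE flatE zero_lfunE => /eqP.
by rewrite scaler_eq0 pnatr_eq0 /= => /eqP.
Qed.

Lemma h_smooth : smooth_hom (E := T) (F := dual_bundle T) h.
Proof.
have sflat := flat_smooth (metric_smooth ph) (Phim_smooth HA).
have := smooth_hom_comp (E := T) (smooth_homZ 2 sflat) (Phip_smooth HA).
by apply: eq_smooth_hom => p v; rewrite comp_lfunE scale_lfunE h_flatm.
Qed.

(** A smooth left inverse of Phi+ or Phi-, defined on all of E; [smooth_hom_inv] cannot supply one,
    since TM and E have ranks n and 2n. The signs cross: [retract Phim] inverts Phi+, and
    [retract Phip] inverts Phi-. *)
Definition retract (Psi : forall p, 'Hom(tangent_space p, E p)) p :
    'Hom(E p, tangent_space p) :=
  ((h p)^-1 \o (2 *: flat tau Psi p))%VF.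

Lemma retract_smooth Psi : smooth_hom (E := T) Psi -> smooth_hom (F := T) (retract Psi).
Proof.
move=> sPsi; apply: (smooth_hom_comp (F := dual_bundle T)).
  by apply: (smooth_hom_inv (E := T) (F := dual_bundle T)) h_smooth => p; apply: h_bij.
exact/smooth_homZ/(flat_smooth (metric_smooth ph)).
Qed.

Lemma retract_Phip p u : retract Phim p (Phip p u) = u.
Proof. by rewrite comp_lfunE scale_lfunE -h_flatm (bij_lfunK (h_bij p)). Qed.

Lemma retract_Phim p u : retract Phip p (Phim p u) = u.
Proof. by rewrite comp_lfunE scale_lfunE -h_flatp (bij_lfunK (h_bij p)). Qed.

Lemma eigenplus_Phip p u : u \in eigenplus (qc_I A) p -> exists v, u = Phip p v.
Proof. by rewrite -(Hp p).2 => /memv_imgP[v _ ->]; exists v. Qed.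

Lemma eigenminus_Phim p u : u \in eigenminus (qc_I A) p -> exists v, u = Phim p v.
Proof. by rewrite -(Hm p).2 => /memv_imgP[v _ ->]; exists v. Qed.

(** * The induced connections on the tangent bundle *)

Local Notation ntp := (induced_connection (qc_Phip A) (qc_nablap A)).
Local Notation ntm := (induced_connection (qc_Phim A) (qc_nablam A)).

Lemma induced_plus : is_induced_connection Phip (qc_nablap A) ntp.
Proof.
have nP X Y : smooth_field X -> smooth_field Y -> forall p,
    qc_nablap A X (fun q => Phip q (Y q)) p \in eigenplus (qc_I A) p.
  move=> sX sY; have := Phip_section HA sY.
  by case/(connection_section (qc_nablap_connection HA) sX).
split=> [|X Y p sX sY]; last by rewrite limg_lfunVK // (Hp p).2 nP.
(* Transport from E+ to all of TM, with [retract Phim] and Phi+ as the two mutually inverse maps. *)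
apply: (connection_transport (E := E) (F := T) (retract_smooth (Phim_smooth HA))
  (Phip_smooth HA) _ _ _ _ (qc_nablap_connection HA)) => [p u _|p v _|p v _|X t sX [st _] p].
- exact: memvf.
- exact: Phip_in.
- exact: retract_Phip.
(* [retract Phim] and the inverse in [induced_connection] are both left inverses of Phi+, so they
   agree on the value of nabla+, which lies in E+ = im Phi+. *)
- have [v vE] := eigenplus_Phip (nP X t sX st p).
  by rewrite /induced_connection vE retract_Phip lker0_lfunK //; have [] := Hp p.
Qed.

Lemma induced_minus : is_induced_connection Phim (qc_nablam A) ntm.
Proof.
have nP X Y : smooth_field X -> smooth_field Y -> forall p,
    qc_nablam A X (fun q => Phim q (Y q)) p \in eigenminus (qc_I A) p.
  move=> sX sY; have := Phim_section HA sY.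
  by case/(connection_section (qc_nablam_connection HA) sX).
split=> [|X Y p sX sY]; last by rewrite limg_lfunVK // (Hm p).2 nP.
apply: (connection_transport (E := E) (F := T) (retract_smooth (Phip_smooth HA))
  (Phim_smooth HA) _ _ _ _ (qc_nablam_connection HA)) => [p u _|p v _|p v _|X t sX [st _] p].
- exact: memvf.
- exact: Phim_in.
- exact: retract_Phim.
- have [v vE] := eigenminus_Phim (nP X t sX st p).
  by rewrite /induced_connection vE retract_Phim lker0_lfunK //; have [] := Hm p.
Qed.

(** * The isomorphism onto the standard structure *)

Local Notation B := (std_data h ntp ntm).

Definition std_iso p : 'Hom(qc_bundle A p, qc_bundle B p) :=
  linfun (fun u : E p => (retract Phim p u, flatp p u) : std_bundle M p).

Lemma std_isoE p u : std_iso p u = (retract Phim p u, flatp p u).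
Proof.
pose f (u : E p) : std_bundle M p := (retract Phim p u, flatp p u).
have lin : linear f by move=> a x y; rewrite /f !linearP.
pose L : {linear E p -> std_bundle M p} := HB.pack f (GRing.isLinear.Build _ _ _ _ _ lin).
exact: (lfunE L).
Qed.

Lemma std_iso_smooth : smooth_hom std_iso.
Proof.
apply/smooth_homP => a w; have oa := triv_open a.
have s1 := smooth_hom_section oa (retract_smooth (Phim_smooth HA)) (smooth_frame a w).
have s2 := smooth_hom_section oa (flat_smooth (metric_smooth ph) (Phip_smooth HA))
  (smooth_frame a w).
apply: smooth_section_eq (smooth_section_pair oa s1 s2) => // p _.
by rewrite std_isoE.
Qed.

(** Isotropy makes each component of [std_iso] see only one eigenbundle; the factor 1/2 undoes the 2
    in [h_flatp]. *)
Lemma std_iso_Phi p X Y : std_iso p (Phip p X + Phim p Y) = (X, 2^-1 *: h p Y).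
Proof.
rewrite std_isoE !linearD /= retract_Phip (flatp_plus (Phip_in X)) add0r.
rewrite h_flatp scalerA mulVf ?pnatr_eq0 // scale1r; congr (_, _).
by rewrite [in LHS]comp_lfunE scale_lfunE (flatm_minus (Phim_in Y)) scaler0 linear0 addr0.
Qed.

Lemma Phi_decomposition p u : exists X Y, u = Phip p X + Phim p Y.
Proof.
have [X XE] := eigenplus_Phip (projplus_in (qc_I A) u).
have [Y YE] := eigenminus_Phim (projminus_in (qc_I A) u).
by exists X, Y; rewrite -XE -YE (proj_add ph).
Qed.

Lemma std_iso_bij p : bijective (std_iso p).
Proof.
apply: (@lker0_bij _ _ _ _ E (std_bundle M)).
rewrite -subv0; apply/subvP => u; have [X [Y ->]] := Phi_decomposition u.
rewrite memv_ker std_iso_Phi memv0 => /eqP[-> /eqP].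
rewrite scaler_eq0 invr_eq0 pnatr_eq0 /= -memv_ker (eqP (bij_lker0 (h_bij p))) memv0.
by move=> /eqP->; rewrite !linear0 addr0.
Qed.

Lemma std_iso_Phip p X : std_iso p (Phip p X) = (X, 0).
Proof. by rewrite -[Phip p X]addr0 -(linear0 (Phim p)) std_iso_Phi linear0 scaler0. Qed.

Lemma std_iso_Phim p Y : std_iso p (Phim p Y) = (0, 2^-1 *: h p Y).
Proof. by rewrite -[Phim p Y]add0r -(linear0 (Phip p)) std_iso_Phi. Qed.

(** The smooth retraction yields a smooth field Y, so that conditions on sections of E+ can be
    tested on the form Phi+ Y. *)
Lemma section_Phip s : section_in (eigenplus (qc_I A)) s ->
  exists2 Y : vector_field M, smooth_field Y & s = fun q => Phip q (Y q).
Proof.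
move=> [ss sE]; exists (fun q => retract Phim q (s q)).
  apply/smooth_sectionT/smooth_hom_section; [exact: openT| |exact/smooth_sectionT].
  exact: retract_smooth (Phim_smooth HA).
apply: functional_extensionality_dep => q.
by have [v ->] := eigenplus_Phip (sE q); rewrite retract_Phip.
Qed.

Lemma section_Phim s : section_in (eigenminus (qc_I A)) s ->
  exists2 Y : vector_field M, smooth_field Y & s = fun q => Phim q (Y q).
Proof.
move=> [ss sE]; exists (fun q => retract Phip q (s q)).
  apply/smooth_sectionT/smooth_hom_section; [exact: openT| |exact/smooth_sectionT].
  exact: retract_smooth (Phip_smooth HA).
apply: functional_extensionality_dep => q.
by have [v ->] := eigenminus_Phim (sE q); rewrite retract_Phim.
Qed.

Lemma std_nablam_h X Y p :
  std_nablam h ntm X (fun q => (0, h q (Y q))) p = (0, h p (ntm X Y p)).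
Proof.
rewrite /std_nablam; congr (0, h p (ntm X _ p)).
by apply: functional_extensionality_dep => q; rewrite (bij_lfunK (h_bij q)).
Qed.

(** Used to move the factor 1/2 of [std_iso_Phim] through the connection; it is the Leibniz rule for
    a constant function, whose derivative term vanishes. *)
Lemma ntmZ (c : R) X Y p : smooth_field X -> smooth_field Y ->
  ntm X (fun q => c *: Y q) p = c *: ntm X Y p.
Proof.
move=> sX sY; have TY : section_in (E := T) (fun=> fullv) Y.
  by split=> // q; rewrite memvf.
have := connection_leibniz induced_minus.1 p (smooth_cst setT c) sX TY.
move=> ->; rewrite /deriv_along (_ : _ \o _ = cst c) //.
by rewrite derive_cst scale0r add0r.
Qed.

(** Every vector is of the form Phi+ X + Phi- Y, so each pointwise condition reduces to the explicit
    value in [std_iso_Phi]. *)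
Lemma std_isomorphism : quasi_codazzi_iso (A := A) (B := B) std_iso.
Proof.
split.
- exact: std_iso_bij.
- exact: std_iso_smooth.
- exact: smooth_hom_inv std_iso_bij std_iso_smooth.
- by move=> p v; rewrite (Phi_split HA) std_iso_Phi /= std_PhiE.
- move=> p u; have [X [Y ->]] := Phi_decomposition u.
  have /eqP Ip : qc_I A p (Phip p X) == Phip p X by rewrite -eigenplusE Phip_in.
  have /eqP Im : qc_I A p (Phim p Y) == - Phim p Y by rewrite -eigenminusE Phim_in.
  rewrite (linearD (qc_I A p)) /= Ip Im -linearN !std_iso_Phi std_IE /=.
  by rewrite linearN scalerN.
(* Only the mixed terms survive on the given side; on the standard side h(Y)/2 evaluated at X' is
   tau(Phi- Y, Phi+ X'). *)
- move=> p u v; have [X [Y ->]] := Phi_decomposition u.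
  have [X' [Y' ->]] := Phi_decomposition v.
  rewrite !std_iso_Phi /= std_tauE /= !h_flatp !scalerA mulVf ?pnatr_eq0 // !scale1r.
  rewrite !flatE (linearD (tau p)) add_lfunE /= !linearD /=.
  rewrite (metric_plus ph (Phip_in X) (Phip_in X')).
  rewrite (metric_minus ph (Phim_in Y) (Phim_in Y')) add0r addr0.
  by rewrite (Defs.metric_sym ph (Phip p X)).
- move=> X s p sX /section_Phip[Y sY ->].
  rewrite -induced_plus.2 // std_iso_Phip /= /std_nablap; congr (ntp X _ p, 0).
  by apply: functional_extensionality_dep => q; rewrite std_iso_Phip.
- move=> X s p sX /section_Phim[Y sY ->].
  (* The second component is h(Y)/2, so [std_nablam] differentiates Y/2; linearity of h and [ntmZ]
     take the factor out. *)
  rewrite -induced_minus.2 // std_iso_Phim /= /std_nablam -linearZ -ntmZ //.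
  congr (0, h p (ntm X _ p)); apply: functional_extensionality_dep => q.
  by rewrite std_iso_Phim /= -linearZ (bij_lfunK (h_bij q)).
Qed.

End Proposition.

Unset Implicit Arguments.
Theorem proposition3p25 (R : realType) (n : nat) (M : manifold R n)
    (A : quasi_codazzi_data M) :
  quasi_codazzi A ->
  (forall p, lker (qc_Phip A p) == 0%VS /\
             limg (qc_Phip A p) = eigenplus (qc_I A) p) ->
  (forall p, lker (qc_Phim A p) == 0%VS /\
             limg (qc_Phim A p) = eigenminus (qc_I A) p) ->
  let ntp := induced_connection (qc_Phip A) (qc_nablap A) in
  let ntm := induced_connection (qc_Phim A) (qc_nablam A) in
  let B := std_data (qc_h A) ntp ntm in
  [/\ is_induced_connection (qc_Phip A) (qc_nablap A) ntp,
      is_induced_connection (qc_Phim A) (qc_nablam A) ntm,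
      (forall (X Y : vector_field M) p, smooth_field X -> smooth_field Y ->
         std_nablam (qc_h A) ntm X (fun q => (0, qc_h A q (Y q))) p
           = (0, qc_h A p (ntm X Y p))),
      quasi_codazzi B
    & quasi_codazzi_isomorphic A B].
Proof.
move=> HA Hp Hm ntp ntm B.
have iso : quasi_codazzi_iso (A := A) (B := B) (std_iso A) by apply: std_isomorphism.
split.
- exact: induced_plus.
- exact: induced_minus.
- by move=> X Y p _ _; apply: std_nablam_h.
(* Both structures carry literally the same h, so the equality required for the transport holds by
   computation. *)
- exact: quasi_codazzi_transport HA iso (fun=> erefl).
- by exists (std_iso A).
Qed.
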